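(* Let $\mathcal K=\mathcal K_1\times\cdots\times\mathcal K_J$ be a product of second-order cones $\mathcal K_i\subset\mathbb{R}^{m_i}$, $m=\sum_{i=1}^Jm_i$, let $\Lambda\subseteq\mathbb{R}^l$ be closed, and let $F:\mathbb{R}^n\to\mathbb{R}^l$, $G=(G_1,\dots,G_J),H=(H_1,\dots,H_J):\mathbb{R}^n\to\mathbb{R}^m$ be continuously differentiable with $G_i,H_i:\mathbb{R}^n\to\mathbb{R}^{m_i}$. Let $\mathcal F$ be the set of $z\in\mathbb{R}^n$ with $\mathcal K\ni G(z)\perp H(z)\in\mathcal K$ and $F(z)\in\Lambda$, and let $z^*\in\mathcal F$. Consider the following two conditions. (A) For every $0\neq w\in\mathbb{R}^n$ with $\nabla F(z^* )w\in T_\Lambda(F(z^* ))$ and $(\nabla G_i(z^* )w,\nabla H_i(z^* )w)\in T_{\Omega_i}(G_i(z^* ),H_i(z^* ))$, $i=1,\dots,J$, one has $$\left.\begin{array}{l}\nabla F(z^* )^T\lambda^F+\sum_{i=1}^J\{\nabla G_i(z^* )^T\lambda_i^G+\nabla H_i(z^* )^T\lambda_i^H\}=0,\\ \lambda^F\in N_\Lambda(F(z^* );\nabla F(z^* )w),\\ (\lambda_i^G,\lambda_i^H)\in N_{\Omega_i}\big((G_i(z^* ),H_i(z^* ));(\nabla G_i(z^* )w,\nabla H_i(z^* )w)\big),\ i=1,\dots,J\end{array}\right\}\Longrightarrow(\lambda^F,\lambda^G,\lambda^H)=0.$$ (B) For every $0\neq w\in\mathbb{R}^n$ with $\nabla F(z^*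 )w\in T_\Lambda(F(z^* ))$ and $(\nabla G(z^* )w,\nabla H(z^* )w)\in T_\Omega(G(z^* ),H(z^* ))$, one has $$\left.\begin{array}{l}\nabla F(z^* )^T\lambda^F+\nabla G(z^* )^T\lambda^G+\nabla H(z^* )^T\lambda^H=0,\\ \lambda^F\in N_\Lambda(F(z^* );\nabla F(z^* )w),\\ (\lambda^G,\lambda^H)\in N_\Omega\big((G(z^* ),H(z^* ));(\nabla G(z^* )w,\nabla H(z^* )w)\big)\end{array}\right\}\Longrightarrow(\lambda^F,\lambda^G,\lambda^H)=0.$$ Conditions (A) and (B) are equivalent, and if (A) (equivalently (B)) holds, then the system $\mathcal K\ni G(z)\perp H(z)\in\mathcal K$, $F(z)\in\Lambda$ has a local error bound at $z^*$.
   Context: $\mathcal K_i=\{(x_1,x_2)\in\mathbb{R}\times\mathbb{R}^{m_i-1}:x_1\ge\|x_2\|\}$ ($=\mathbb{R}_+$ if $m_i=1$). $\Omega=\{(x,y)\in\mathbb{R}^m\times\mathbb{R}^m:\mathcal K\ni x\perp y\in\mathcal K\}$, $\Omega_i=\{(x,y)\in\mathbb{R}^{m_i}\times\mathbb{R}^{m_i}:\mathcal K_i\ni x\perp y\in\mathcal K_i\}$; $\lambda^G=(\lambda_1^G,\dots,\lambda_J^G)$, $\lambda^H=(\lambda_1^H,\dots,\lambda_J^H)$ with $\lambda_i^G,\lambda_i^H\in\mathbb{R}^{m_i}$. $\nabla$ denotes the Jacobian matrix; $d_C(z)=d(z,C)$ is Euclidean distance. The system has a local error bound at $z^*\in\mathcal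 F$ if there are $\kappa>0$ and a neighborhood $U$ of $z^*$ with $d(z,\mathcal F)\le\kappa\{d_\Lambda(F(z))+\sum_{i=1}^Jd_{\Omega_i}(G_i(z),H_i(z))\}$ for all $z\in U$. For $C\subseteq\mathbb{R}^n$, $z\in C$: $T_C(z)=\{u:\exists t_k\downarrow 0,\ u_k\to u \text{ with } z+t_ku_k\in C\ \forall k\}$; regular normal cone $\widehat N_C(z)=\{v:\langle v,z'-z\rangle\le o(\|z'-z\|)\ \forall z'\in C\}$ for $z\in C$ and $\emptyset$ for $z\notin C$; directional limiting normal cone $N_C(z;d)=\{v:\exists t_k\downarrow0,\ d_k\to d,\ v_k\to v\text{ with }v_k\in\widehat N_C(z+t_kd_k)\ \forall k\}$. *)

(* Defs.v *)
From HB Require Import structures.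
From mathcomp Require Import all_boot all_order all_algebra.
From mathcomp Require Import all_classical all_reals all_analysis.

Set Implicit Arguments.
Unset Strict Implicit.
Unset Printing Implicit Defensive.

Import Order.TTheory GRing.Theory Num.Theory.
Import numFieldNormedType.Exports.

Local Open Scope classical_set_scope.
Local Open Scope ring_scope.

(* Points of R^p are row vectors.  The library norm on ['rV[R]_p] is the sup
   norm: it induces the usual topology, differentiability and Jacobians, but
   the Euclidean norm and distance have to be defined separately.
   With row vectors, ['J f z] is the transpose of the usual Jacobian matrix
   nabla f(z): nabla f(z) w is [w *m 'J f z], and nabla f(z)^T lam is
   [lam *m ('J f z)^T].
   The product R^p x R^q is ['rV[R]_(p + q)], with pairs [row_mx x y]. *)

Section Euclidean.
Context {R : realType} {p : nat}.
Implicit Types (x y z : 'rV[R]_p) (C : set 'rV[R]_p).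

Definition dotv x y : R := \sum_(j < p) x 0 j * y 0 j.

Definition enorm x : R := Num.sqrt (dotv x x).

Definition edistance C z : R := inf [set enorm (z - y) | y in C].

End Euclidean.

Definition C1 {R : realType} {n p : nat} (f : 'rV[R]_n -> 'rV[R]_p) : Prop :=
  (forall z, differentiable f z) /\ continuous (fun z => 'J f z).

Section VariationalGeometry.
Context {R : realType} {p : nat}.
Implicit Types (C : set 'rV[R]_p) (z d : 'rV[R]_p).

Definition tangent_cone C z : set 'rV[R]_p :=
  [set u | exists (t : nat -> R) (u_ : nat -> 'rV[R]_p),
    [/\ forall k, 0 < t k, t @ \oo --> (0 : R), u_ @ \oo --> u
      & forall k, C (z + t k *: u_ k)]].

Definition regular_normal_cone C z : set 'rV[R]_p :=
  [set v | C z /\ forall e : R, 0 < e ->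
    \forall z' \near z, C z' -> dotv v (z' - z) <= e * enorm (z' - z)].

Definition dir_normal_cone C z d : set 'rV[R]_p :=
  [set v | exists (t : nat -> R) (d_ v_ : nat -> 'rV[R]_p),
    [/\ forall k, 0 < t k, t @ \oo --> (0 : R), d_ @ \oo --> d, v_ @ \oo --> v
      & forall k, regular_normal_cone C (z + t k *: d_ k) (v_ k)]].

End VariationalGeometry.

(* Second-order cone of R^(k+1); [col' 0 x] is x without its first entry. *)
Definition soc {R : realType} {k : nat} : set 'rV[R]_k.+1 :=
  [set x | enorm (col' 0 x) <= x 0 0].

Definition soc_prod {R : realType} {J : nat} {k : 'I_J -> nat} :
    set 'rV[R]_(\sum_(i < J) (k i).+1) :=
  [set x | forall i, soc (submxrow x i)].

Definition compl_set {R : realType} {p : nat} (K : set 'rV[R]_p) :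
    set 'rV[R]_(p + p) :=
  [set u | [/\ K (lsubmx u), K (rsubmx u) & dotv (lsubmx u) (rsubmx u) = 0]].

(* The i-th cone lies in R^(m_i) with m_i = (k i).+1, so that m_i >= 1, and
   block [i] of a vector of R^m, m = sum_i m_i, is given by [submxrow]. *)
Section ComplementaritySystem.
Context {R : realType} {n l J : nat} (k : 'I_J -> nat).
Local Notation m := (\sum_(i < J) (k i).+1)%N.
Variables (Lambda : set 'rV[R]_l) (F : 'rV[R]_n -> 'rV[R]_l).
Variables (G H : 'rV[R]_n -> 'rV[R]_m) (zs : 'rV[R]_n).

Definition block (f : 'rV[R]_n -> 'rV[R]_m) (i : 'I_J) :
    'rV[R]_n -> 'rV[R]_(k i).+1 :=
  fun z => submxrow (f z) i.

Definition Omega : set 'rV[R]_(m + m) := compl_set soc_prod.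

Definition Omega_block (i : 'I_J) : set 'rV[R]_((k i).+1 + (k i).+1) :=
  compl_set soc.
Arguments Omega_block i : clear implicits.

Definition feasible : set 'rV[R]_n :=
  [set z | [/\ soc_prod (G z), soc_prod (H z),
               dotv (G z) (H z) = 0 & Lambda (F z)]].

Definition local_error_bound : Prop :=
  exists2 kappa : R, 0 < kappa & \forall z \near zs,
    edistance feasible z <=
      kappa * (edistance Lambda (F z) +
        \sum_(i < J)
          edistance (Omega_block i) (row_mx (block G i z) (block H i z))).

Definition conditionA : Prop :=
  forall w : 'rV[R]_n, w != 0 ->
  tangent_cone Lambda (F zs) (w *m 'J F zs) ->
  (forall i : 'I_J,
    tangent_cone (Omega_block i) (row_mx (block G i zs) (block H i zs))
      (row_mx (w *m 'J (block G i) zs) (w *m 'J (block H i) zs))) ->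
  forall (lF : 'rV[R]_l) (lG lH : 'rV[R]_m),
  lF *m ('J F zs)^T +
    \sum_(i < J) (submxrow lG i *m ('J (block G i) zs)^T +
                  submxrow lH i *m ('J (block H i) zs)^T) = 0 ->
  dir_normal_cone Lambda (F zs) (w *m 'J F zs) lF ->
  (forall i : 'I_J,
    dir_normal_cone (Omega_block i) (row_mx (block G i zs) (block H i zs))
      (row_mx (w *m 'J (block G i) zs) (w *m 'J (block H i) zs))
      (row_mx (submxrow lG i) (submxrow lH i))) ->
  [/\ lF = 0, lG = 0 & lH = 0].

Definition conditionB : Prop :=
  forall w : 'rV[R]_n, w != 0 ->
  tangent_cone Lambda (F zs) (w *m 'J F zs) ->
  tangent_cone Omega (row_mx (G zs) (H zs))
    (row_mx (w *m 'J G zs) (w *m 'J H zs)) ->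
  forall (lF : 'rV[R]_l) (lG lH : 'rV[R]_m),
  lF *m ('J F zs)^T + lG *m ('J G zs)^T + lH *m ('J H zs)^T = 0 ->
  dir_normal_cone Lambda (F zs) (w *m 'J F zs) lF ->
  dir_normal_cone Omega (row_mx (G zs) (H zs))
    (row_mx (w *m 'J G zs) (w *m 'J H zs)) (row_mx lG lH) ->
  [/\ lF = 0, lG = 0 & lH = 0].

End ComplementaritySystem.

(* Main.v *)
(* Error bound: if it fails, there are points z_k -> zs violating it with
   constants tending to infinity.  Minimizing the distance of (F, G, H)(z) to
   Lambda x Omega plus a small multiple of |z - z_k| and projecting on
   Lambda x Omega yields unit normals v_k with v_k almost annihilated by the
   adjoint Jacobian, at points whose distance to (F, G, H)(zs) is governed by
   |z - zs|; cluster points of v_k and of the directions contradict (B).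

   Equivalence: Omega is the product of the Omega_i, and tangents and directional
   normals of a product always have components in the factors, so (A) implies
   (B).  The converse inclusions need sequences in the factors with a common
   step size t_k.  Each Omega_i is, near each of its points and in suitable C^1
   coordinates, a cone with apex at that point; rescaling in these coordinates
   turns a sequence with given steps into one with prescribed steps.  Near
   (x, y) with x on the boundary of the cone, x <> 0, the coordinates are
   x_1 - |x_2|, x_2, y_1 and y_2 + y_1 x_2 / |x_2|. *)
Require Import Defs.
From HB Require Import structures.
From mathcomp Require Import all_boot all_order all_algebra.
From mathcomp Require Import all_classical all_reals all_analysis.
From mathcomp Require Import lra.
Import numFieldNormedType.Exports.
Local Open Scope classical_set_scope.
Local Open Scope ring_scope.

Set Implicit Arguments.
Unset Strict Implicit.
Unset Printing Implicit Defensive.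

Import Order.TTheory GRing.Theory Num.Theory.

(** * Euclidean norm and distance *)

Section MatrixConvergence.
Context {R : realType} {T : Type} {F : set_system T} {FF : Filter F}.

Lemma cvg_mxP m n (f : T -> 'M[R]_(m, n)) (a : 'M[R]_(m, n)) :
  f @ F --> a <-> forall i j, (fun t => f t i j) @ F --> a i j.
Proof.
split=> [fa i j|h].
  apply: (@continuous_cvg T 'M[R]_(m, n) R F FF f (fun x => x i j) a) => //.
  exact: coord_continuous.
apply/cvg_ballP => e e0.
have : \forall t \near F, forall i j, ball (a i j) e (f t i j).
  by do 2![apply: filter_forall => ?]; exact: (proj1 (cvg_ballP _ _) (h _ _)).
by apply: filterS => t ht; split.
Qed.

Lemma cvg_sumr (I : Type) (r : seq I) (f : I -> T -> R) (a : I -> R) :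
  (forall i, f i @ F --> a i) ->
  (fun t => \sum_(i <- r) f i t) @ F --> \sum_(i <- r) a i.
Proof. by move=> h; apply: cvg_big => //; exact: add_continuous. Qed.

Lemma cvg_mulmx m n p (f : T -> 'M[R]_(m, n)) (g : T -> 'M[R]_(n, p))
    (a : 'M[R]_(m, n)) (b : 'M[R]_(n, p)) :
  f @ F --> a -> g @ F --> b -> (fun t => f t *m g t) @ F --> a *m b.
Proof.
move=> /cvg_mxP fa /cvg_mxP gb; apply/cvg_mxP => i j.
rewrite mxE; under eq_cvg do rewrite mxE.
by apply: cvg_sumr => k; exact: cvgM.
Qed.

Lemma cvg_trmx m n (f : T -> 'M[R]_(m, n)) (a : 'M[R]_(m, n)) :
  f @ F --> a -> (fun t => (f t)^T) @ F --> a^T.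
Proof.
move=> /cvg_mxP fa; apply/cvg_mxP => i j.
by rewrite mxE; under eq_cvg do rewrite mxE; exact: fa.
Qed.

Lemma cvg_row_mx m n p (f : T -> 'M[R]_(m, n)) (g : T -> 'M[R]_(m, p))
    (a : 'M[R]_(m, n)) (b : 'M[R]_(m, p)) :
  f @ F --> a -> g @ F --> b -> (fun t => row_mx (f t) (g t)) @ F --> row_mx a b.
Proof.
move=> /cvg_mxP fa /cvg_mxP gb; apply/cvg_mxP => i j.
have [l ->|l ->] := split_ordP j.
  by rewrite row_mxEl; under eq_cvg do rewrite row_mxEl; exact: fa.
by rewrite row_mxEr; under eq_cvg do rewrite row_mxEr; exact: gb.
Qed.

End MatrixConvergence.

Section EuclideanSpace.
Context {R : realType} {p : nat}.
Implicit Types (x y z : 'rV[R]_p) (C : set 'rV[R]_p).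

Lemma dotvE x y : dotv x y = (x *m y^T) 0 0.
Proof. by rewrite mxE; apply: eq_bigr => j _; rewrite mxE. Qed.

Lemma dotvC x y : dotv x y = dotv y x.
Proof. by apply: eq_bigr => j _; rewrite mulrC. Qed.

Lemma dotvDl x y z : dotv (x + y) z = dotv x z + dotv y z.
Proof. by rewrite !dotvE mulmxDl mxE. Qed.

Lemma dotvZl a x y : dotv (a *: x) y = a * dotv x y.
Proof. by rewrite !dotvE -scalemxAl mxE. Qed.

Lemma dotvNl x y : dotv (- x) y = - dotv x y.
Proof. by rewrite -scaleN1r dotvZl mulN1r. Qed.

Lemma dotvDr x y z : dotv z (x + y) = dotv z x + dotv z y.
Proof. by rewrite !(dotvC z) dotvDl. Qed.

Lemma dotvZr a x y : dotv y (a *: x) = a * dotv y x.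
Proof. by rewrite !(dotvC y) dotvZl. Qed.

Lemma dotvNr x y : dotv y (- x) = - dotv y x.
Proof. by rewrite !(dotvC y) dotvNl. Qed.

Definition dotvB := (dotvDl, dotvDr, dotvNl, dotvNr).

Lemma dotv0l x : dotv 0 x = 0.
Proof. by rewrite -(scale0r 0) dotvZl mul0r. Qed.

Lemma dotv_ge0 x : 0 <= dotv x x.
Proof. by apply: sumr_ge0 => j _; rewrite -expr2 sqr_ge0. Qed.

Lemma dotv_eq0 x : (dotv x x == 0) = (x == 0).
Proof.
apply/eqP/eqP => [/eqP|->]; last exact: dotv0l.
rewrite psumr_eq0; last by move=> j _; rewrite -expr2 sqr_ge0.
move=> /allP h; apply/rowP => j; rewrite mxE; apply/eqP.
by have := h j (mem_index_enum j); rewrite /= mulf_eq0 orbb.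
Qed.

Lemma enorm_ge0 x : 0 <= enorm x.
Proof. exact: sqrtr_ge0. Qed.

Lemma sqr_enorm x : enorm x ^+ 2 = dotv x x.
Proof. by rewrite sqr_sqrtr// dotv_ge0. Qed.

Lemma enorm_eq0 x : (enorm x == 0) = (x == 0).
Proof. by rewrite -sqrf_eq0 sqr_enorm dotv_eq0. Qed.

Lemma enorm_gt0 x : (0 < enorm x) = (x != 0).
Proof. by rewrite lt_def enorm_ge0 andbT enorm_eq0. Qed.

Lemma enorm0 : enorm (0 : 'rV[R]_p) = 0.
Proof. by apply/eqP; rewrite enorm_eq0. Qed.

Lemma enormZ a x : enorm (a *: x) = `|a| * enorm x.
Proof.
by rewrite /enorm dotvZl dotvZr mulrA -expr2 sqrtrM ?sqr_ge0// sqrtr_sqr.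
Qed.

Lemma enormN x : enorm (- x) = enorm x.
Proof. by rewrite -scaleN1r enormZ normrN1 mul1r. Qed.

Lemma enormBC x y : enorm (x - y) = enorm (y - x).
Proof. by rewrite -enormN opprB. Qed.

(** Cauchy-Schwarz: the square of the norm of [|y| x - |x| y] is nonnegative, and its expansion is
    divided by [|x| |y|]. *)
Lemma dotv_le x y : dotv x y <= enorm x * enorm y.
Proof.
have [->|x0] := eqVneq x 0; first by rewrite dotv0l enorm0 mul0r.
have [->|y0] := eqVneq y 0; first by rewrite dotvC dotv0l enorm0 mulr0.
have xp : 0 < enorm x by rewrite enorm_gt0.
have yp : 0 < enorm y by rewrite enorm_gt0.
have := dotv_ge0 (enorm y *: x - enorm x *: y).
rewrite !dotvB !(dotvZl, dotvZr) (dotvC y x) -!sqr_enorm => h.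
have : 0 <= (enorm x * enorm y) * (enorm x * enorm y - dotv x y) by nra.
by rewrite pmulr_rge0 ?mulr_gt0// subr_ge0.
Qed.

Lemma sqr_enormD x y :
  enorm (x + y) ^+ 2 = enorm x ^+ 2 + dotv x y *+ 2 + enorm y ^+ 2.
Proof. by rewrite !sqr_enorm !dotvB (dotvC y x) mulr2n !addrA. Qed.

Lemma enormD x y : enorm (x + y) <= enorm x + enorm y.
Proof.
rewrite -(@ler_sqr R) ?nnegrE ?addr_ge0 ?enorm_ge0//.
by rewrite sqr_enormD sqrrD lerD2r lerD2l lerMn2r dotv_le orbT.
Qed.

Lemma enorm_triangle z x y : enorm (x - y) <= enorm (x - z) + enorm (z - y).
Proof. by rewrite (_ : x - y = (x - z) + (z - y)) ?enormD// addrA subrK. Qed.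

Lemma norm_coord x j : `|x 0 j| <= `|x|.
Proof. by rewrite -[leRHS]/(mx_norm x) mx_normrE (le_bigmax _ _ (0, j)). Qed.

Lemma norm_le_enorm x : `|x| <= enorm x.
Proof.
rewrite -[leLHS]/(mx_norm x) mx_normrE.
apply/bigmax_leP; split; [exact: enorm_ge0|move=> [i j] _ /=].
rewrite ord1 -sqrtr_sqr ler_sqrt ?dotv_ge0// /dotv (bigD1 j)//= -expr2 lerDl.
by apply: sumr_ge0 => k _; rewrite -expr2 sqr_ge0.
Qed.

Lemma enorm_le_norm x : enorm x <= p%:R * `|x|.
Proof.
have [p0|p0] := posnP p.
  suff -> : x = 0 by rewrite enorm0 normr0 mulr0.
  by apply/rowP => -[j hj]; move: hj (hj); rewrite {1}p0.
rewrite -[p%:R * _]ger0_norm ?mulr_ge0//.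
rewrite -sqrtr_sqr ler_sqrt ?sqr_ge0// exprMn.
apply: (@le_trans _ _ (p%:R * `|x| ^+ 2)).
  rewrite /dotv -[p in p%:R]card_ord mulr_natl -sumr_const.
  apply: ler_sum => j _; rewrite -expr2 -real_normK ?num_real//.
  by rewrite lerXn2r ?nnegrE ?norm_coord.
rewrite ler_wpM2r ?sqr_ge0// expr2 ler_peMl ?ler1n//.
Qed.

Lemma cvg_dotv (T : Type) (F : set_system T) (FF : Filter F)
    (f g : T -> 'rV[R]_p) (a b : 'rV[R]_p) : f @ F --> a -> g @ F --> b ->
  (fun t => dotv (f t) (g t)) @ F --> dotv a b.
Proof.
move=> fa gb; rewrite /dotv.
apply: cvg_sumr => j.
by apply: cvgM; [move/cvg_mxP: fa|move/cvg_mxP: gb]; exact.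
Qed.

Lemma cvg_enorm (T : Type) (F : set_system T) (FF : Filter F)
    (f : T -> 'rV[R]_p) (a : 'rV[R]_p) :
  f @ F --> a -> (fun t => enorm (f t)) @ F --> enorm a.
Proof.
move=> fa.
apply: (@continuous_cvg T R R F FF _ (@Num.sqrt R)); first exact: sqrt_continuous.
exact: cvg_dotv.
Qed.

Lemma enorm_cvg0 (T : Type) (F : set_system T) (FF : Filter F)
    (f : T -> 'rV[R]_p) :
  (fun t => enorm (f t)) @ F --> (0 : R) -> f @ F --> (0 : 'rV[R]_p).
Proof.
move=> h; apply/norm_cvg0P.
apply: (squeeze_cvgr _ (cvg_cst (0 : R)) h).
by apply: nearW => t; rewrite normr_ge0 norm_le_enorm.
Qed.

Lemma enormB_cvg0 x : (fun y => enorm (y - x)) @ x --> (0 : R).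
Proof.
rewrite -[X in _ --> X](@enorm0) -(subrr x).
by apply: (@cvg_enorm _ (nbhs x)); apply: cvgB; [exact: cvg_id|exact: cvg_cst].
Qed.

Lemma edistance_le C x y : C y -> edistance C x <= enorm (x - y).
Proof.
move=> Cy; apply: ge_inf; last by exists y.
by exists 0 => _ [z _ <-]; exact: enorm_ge0.
Qed.

Lemma edistance_ge0 C x : 0 <= edistance C x.
Proof.
(* On the empty set [inf] takes the default value 0. *)
have [->|/set0P[y Cy]] := eqVneq C set0; first by rewrite /edistance image_set0 inf0.
by apply: lb_le_inf; [exists (enorm (x - y)), y|move=> _ [z _ <-]; exact: enorm_ge0].
Qed.

(** The growth bound makes the sublevel set of any point of [C] bounded, so that [f] attains its
    minimum over a compact set. It yields both projections and the minimizer of the penalized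
    problem. *)
Lemma coercive_argmin C (f : 'rV[R]_p -> R) (c : R) b :
  closed C -> C !=set0 -> continuous f -> 0 < c ->
  (forall z, c * enorm (z - b) <= f z) ->
  exists2 y, C y & forall z, C z -> f y <= f z.
Proof.
move=> Ccl [a Ca] cf c0 fge.
pose B := C `&` [set z | f z <= f a].
have Bb : bounded_set B.
  exists (`|b| + f a / c); split; first exact: num_real.
  move=> M ltM z [_ /= fz]; apply: ltW; apply: le_lt_trans ltM.
  rewrite -(subrK b z) addrC (le_trans (ler_normD _ _))// lerD2l.
  rewrite (le_trans (norm_le_enorm _))// ler_pdivlMr// mulrC.
  exact: le_trans (fge _) fz.
have Bcl : closed B.
  apply: closedI => //.
  rewrite -[X in closed X]/(f @^-1` [set r | r <= f a]).
  by apply: preimage_closed; [move=> z _; exact: cf|exact: closed_le].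
have [|y /[!inE] -[Cy fy] ymin] := EVT_min_rV (f := f) _
    (bounded_closed_compact Bb Bcl) (continuous_subspaceT cf).
  by exists a; split => //=.
exists y => // z Cz; have [fz|/ltW] := leP (f z) (f a); first by apply: ymin; rewrite inE.
exact: le_trans.
Qed.

Lemma projection C x : closed C -> C !=set0 ->
  exists y, [/\ C y, edistance C x = enorm (x - y) &
    forall z, C z -> enorm (x - y) <= enorm (x - z)].
Proof.
move=> Ccl C0.
have [] := @coercive_argmin C (fun y => enorm (x - y)) 1 x Ccl C0 _ ltr01.
- by move=> y; apply: (@cvg_enorm _ (nbhs y)); apply: cvgB; [exact: cvg_cst|exact: cvg_id].
- by move=> z; rewrite mul1r enormBC.
move=> y Cy ymin; exists y; split => //.
apply: le_anti; rewrite edistance_le//=.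
apply: lb_le_inf; first by exists (enorm (x - y)), y.
by move=> _ [z Cz <-]; exact: ymin.
Qed.

Lemma edistance_lip C x y : closed C -> C !=set0 ->
  edistance C x <= enorm (x - y) + edistance C y.
Proof.
move=> Ccl /(projection y Ccl)[z [Cz -> _]].
exact: le_trans (edistance_le x Cz) (enorm_triangle y _ _).
Qed.

Lemma continuous_edistance C : closed C -> C !=set0 -> continuous (edistance C).
Proof.
move=> Ccl C0 x; apply/(@cvgrPdist_le _ _ _ (nbhs x)) => e e0.
have /cvgrPdist_le/(_ _ e0) : (fun y => enorm (y - x)) @ x --> (0 : R).
  rewrite -[X in _ --> X](@enorm0) -(subrr x).
  by apply: (@cvg_enorm _ (nbhs x)); apply: cvgB; [exact: cvg_id|exact: cvg_cst].
apply: filterS => y; rewrite sub0r normrN ger0_norm ?enorm_ge0// => h.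
rewrite (le_trans _ h)// ler_norml.
have := edistance_lip x y Ccl C0; have := edistance_lip y x Ccl C0.
by rewrite (enormBC x y); lra.
Qed.

End EuclideanSpace.

(** * Jacobians: expansions, difference quotients and chain rule *)

Section Jacobian.
Context {R : realType}.

Lemma mulmx_jacobian n m (f : 'rV[R]_n -> 'rV[R]_m) z h :
  h *m 'J f z = 'd f z h.
Proof. exact: mul_rV_lin1. Qed.

Lemma differentiable_expansion n m (f : 'rV[R]_n -> 'rV[R]_m) z :
  differentiable f z -> forall e : R, 0 < e ->
  \forall y \near z, `|f y - f z - (y - z) *m 'J f z| <= e * `|y - z|.
Proof.
move=> /diff_locally/eqaddoP h e e0.
rewrite (near_shift 0).
have := h e e0; apply: filterS => y.
rewrite /= !fctE /= subr0 addrK mulmx_jacobian => hy.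
by rewrite -addrA -opprD.
Qed.

(** Differentiability in the sense of Hadamard: the directions may vary with the step, because the
    remainder is small relative to [t k * |d k|] and [d k] stays bounded. *)
Lemma quotient_cvg_jacobian n m (f : 'rV[R]_n -> 'rV[R]_m) z (T : Type)
    (F : set_system T) (FF : Filter F) (t : T -> R) (d : T -> 'rV[R]_n)
    (d0 : 'rV[R]_n) :
  differentiable f z -> (forall k, 0 < t k) -> t @ F --> (0 : R) ->
  d @ F --> d0 ->
  (fun k => (t k)^-1 *: (f (z + t k *: d k) - f z)) @ F --> d0 *m 'J f z.
Proof.
move=> df t0 tc dc.
have zc : (fun k => z + t k *: d k) @ F --> z.
  rewrite -[X in _ --> X]addr0 -[X in _ + X](scale0r d0).
  by apply: cvgD; [exact: cvg_cst|exact: cvgZ].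
have dJ : (fun k => d k *m 'J f z) @ F --> d0 *m 'J f z.
  by apply: cvg_mulmx => //; exact: cvg_cst.
rewrite -[X in _ --> X]add0r.
have -> : (fun k => (t k)^-1 *: (f (z + t k *: d k) - f z)) =
  (fun k => (t k)^-1 *: (f (z + t k *: d k) - f z) - d k *m 'J f z + d k *m 'J f z).
  by apply/funext => k; rewrite subrK.
apply: cvgD => //.
apply/cvgr0Pnorm_le => e e0.
have M0 : 0 < `|d0| + 1 by rewrite ltr_wpDl.
have dM : \forall k \near F, `|d k| <= `|d0| + 1.
  move/cvg_norm : dc => /cvgrPdist_le/(_ _ ltr01); apply: filterS => k.
  by rewrite ler_norml; lra.
have := zc _ (differentiable_expansion df (divr_gt0 e0 M0)).
apply: filterS2 dM => k dk /=.
have -> : z + t k *: d k - z = t k *: d k by rewrite addrC addKr.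
rewrite -scalemxAl => hk.
rewrite -[d k *m _]scale1r -[X in X *: (d k *m _)](mulVf (lt0r_neq0 (t0 k))).
rewrite -scalerA -scalerBr normrZ normfV gtr0_norm// ler_pdivrMl//.
apply: le_trans hk _; rewrite normrZ gtr0_norm// mulrCA ler_pM2l//.
by rewrite mulrAC ler_pdivrMr// ler_pM2l.
Qed.

Lemma continuous_mulmxr n m q (A : 'M[R]_(m, q)) :
  continuous (fun x : 'M[R]_(n, m) => x *m A).
Proof.
move=> x; apply: (@cvg_mulmx _ _ (nbhs x)); [exact: cvg_id|exact: cvg_cst].
Qed.

Lemma differentiable_mulmxr n m q (f : 'rV[R]_n -> 'rV[R]_m) (A : 'M[R]_(m, q)) z :
  differentiable f z -> differentiable (fun x => f x *m A) z.
Proof.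
move=> df; apply: (@differentiable_comp _ _ _ _ f (mulmxr A)) => //.
apply: linear_differentiable; exact: continuous_mulmxr.
Qed.

Lemma diff_mulmxr n m (A : 'M[R]_(n, m)) (z : 'rV[R]_n) :
  'd (mulmxr A) z = mulmxr A :> ('rV[R]_n -> 'rV[R]_m).
Proof. by apply: diff_lin; exact: continuous_mulmxr. Qed.

Lemma jacobian_comp n m q (f : 'rV[R]_n -> 'rV[R]_m) (g : 'rV[R]_m -> 'rV[R]_q) z :
  differentiable f z -> differentiable g (f z) ->
  'J (g \o f) z = 'J f z *m 'J g (f z).
Proof.
move=> df dg; apply/row_matrixP => i; rewrite !rowE mulmxA !mulmx_jacobian.
by rewrite diff_comp.
Qed.

Lemma jacobian_mulmxr n m q (f : 'rV[R]_n -> 'rV[R]_m) (A : 'M[R]_(m, q)) z :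
  differentiable f z -> 'J (fun x => f x *m A) z = 'J f z *m A.
Proof.
move=> df; apply/row_matrixP => i; rewrite !rowE mulmxA !mulmx_jacobian.
rewrite (@diff_comp _ _ _ _ f (mulmxr A)) /= ?diff_mulmxr//.
by have := @differentiable_mulmxr _ _ _ id A (f z); apply.
Qed.

End Jacobian.

(** * Regular and directional normals *)

Section NormalCones.
Context {R : realType}.

Lemma dotv_mulmxr n m (v : 'rV[R]_m) (h : 'rV[R]_n) (A : 'M[R]_(n, m)) :
  dotv (v *m A^T) h = dotv v (h *m A).
Proof. by rewrite !dotvE trmx_mul mulmxA. Qed.

Lemma enorm_expansion n m (f : 'rV[R]_n -> 'rV[R]_m) z :
  differentiable f z -> forall e : R, 0 < e ->
  \forall y \near z, enorm (f y - f z - (y - z) *m 'J f z) <= e * enorm (y - z).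
Proof.
move=> df e e0.
(* The factor [m.+1] pays for the passage from the sup norm to the Euclidean norm; the successor
   keeps it nonzero in dimension 0. *)
have e1 : 0 < e / m.+1%:R by rewrite divr_gt0.
have := differentiable_expansion df e1; apply: filterS => y hy.
apply: le_trans (enorm_le_norm _) _.
apply: (@le_trans _ _ (m.+1%:R * (e / m.+1%:R * `|y - z|))).
  by apply: ler_pM => //; rewrite ler_nat.
by rewrite mulrA mulrCA divff// mulr1 ler_pM2l// norm_le_enorm.
Qed.

Lemma mulmxr_bounded n m (A : 'M[R]_(n, m)) :
  exists2 M : R, 0 < M & forall h : 'rV[R]_n, enorm (h *m A) <= M * enorm h.
Proof.
have [M M0 hM] := linear_lipschitz (f := (mulmxr A : 'rV[R]_n -> 'rV[R]_m))
  (@continuous_mulmxr R 1 n m A).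
exists (m.+1%:R * M) => [|h]; first exact: mulr_gt0.
apply: le_trans (enorm_le_norm _) _; rewrite -mulrA.
apply: ler_pM => //; first by rewrite ler_nat.
by apply: le_trans (hM h) _; rewrite ler_pM2l// norm_le_enorm.
Qed.

Lemma enorm_locally_lipschitz n m (f : 'rV[R]_n -> 'rV[R]_m) z :
  differentiable f z -> exists2 L : R, 0 < L &
  \forall y \near z, enorm (f y - f z) <= L * enorm (y - z).
Proof.
move=> df; have [M M0 hM] := mulmxr_bounded ('J f z).
exists (M + 1); first by rewrite ltr_wpDl// ltW.
have := enorm_expansion df ltr01; apply: filterS => y hy.
rewrite -(subrK ((y - z) *m 'J f z) (f y - f z)).
apply: le_trans (enormD _ _) _.
by have := hM (y - z); rewrite mulrDl mul1r; rewrite mul1r in hy; lra.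
Qed.

(** Along points of [C], the product of the pulled back vector with [y - z] differs from
    [dotv v (f y - f z)] by the linearization error. The latter product is at most [o(|f y - f z|)],
    hence [o(|y - z|)] by the Lipschitz estimate at [z]. *)
Lemma regular_normal_pullback n m (C : set 'rV[R]_n) (D : set 'rV[R]_m)
    (f : 'rV[R]_n -> 'rV[R]_m) z v :
  differentiable f z -> C z -> (\forall y \near z, C y -> D (f y)) ->
  regular_normal_cone D (f z) v -> regular_normal_cone C z (v *m ('J f z)^T).
Proof.
move=> df Cz CD [Dfz Nv]; split => // e e0.
have [L L0 hL] := enorm_locally_lipschitz df.
have V0 : 0 < enorm v + 1 by rewrite ltr_wpDl// enorm_ge0.
(* One half of [e] serves the normal inequality in [D], where [L] converts [|f y - f z|] into
   [|y - z|]; the other half serves the linearization error, weighted by the norm of [v], with [+ 1]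
   to cover [v = 0]. *)
have e1 : 0 < e / 2 / L by rewrite !divr_gt0.
have e2 : 0 < e / 2 / (enorm v + 1) by rewrite !divr_gt0.
have fc : {for z, continuous f} by exact: differentiable_continuous.
near=> y => Cy; rewrite dotv_mulmxr.
rewrite -[(y - z) *m _](subKr (f y - f z)) !dotvB.
have h1 : dotv v (f y - f z) <= e / 2 / L * enorm (f y - f z).
  by move: (Cy); near: y; apply: filterS2 CD (fc _ (Nv _ e1)) => y h1 h2 /h1/h2.
have h2 : enorm (f y - f z) <= L * enorm (y - z) by near: y.
have h3 : enorm (f y - f z - (y - z) *m 'J f z) <=
    e / 2 / (enorm v + 1) * enorm (y - z).
  by near: y; exact: enorm_expansion.
have h4 := dotv_le (- v) (f y - f z - (y - z) *m 'J f z).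
have {}h1 : dotv v (f y - f z) <= e / 2 * enorm (y - z).
  apply: le_trans h1 _; rewrite -[e / 2 / L * _]mulrA ler_pM2l ?divr_gt0//.
  by rewrite ler_pdivrMl.
have {}h4 : - dotv v (f y - f z - (y - z) *m 'J f z) <= e / 2 * enorm (y - z).
  rewrite -dotvNl; apply: le_trans h4 _; rewrite enormN.
  apply: le_trans (ler_wpM2l (enorm_ge0 v) h3) _.
  rewrite mulrA ler_wpM2r ?enorm_ge0// mulrCA ler_piMr ?divr_ge0 ?(ltW e0)//.
  by rewrite ler_pdivrMr// mul1r lerDl.
rewrite !dotvB in h1 h4 *; lra.
Unshelve. all: by end_near. Qed.

Lemma differentiable_affine n m (A : 'M[R]_(n, m)) (b : 'rV[R]_n) (c : 'rV[R]_m) z :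
  differentiable (fun y => c + (y - b) *m A) z.
Proof.
apply: differentiableD => //; apply: differentiable_mulmxr.
by apply: differentiableB.
Qed.

Lemma jacobian_affine n m (A : 'M[R]_(n, m)) (b : 'rV[R]_n) (c : 'rV[R]_m) z :
  'J (fun y => c + (y - b) *m A) z = A.
Proof.
apply/row_matrixP => i; rewrite !rowE mulmx_jacobian.
have -> : (fun y => c + (y - b) *m A) = cst (c - b *m A) + mulmxr A.
  by apply/funext => y; rewrite [RHS]/= fctE mulmxBl addrCA addrC.
have dl : differentiable (mulmxr A : 'rV[R]_n -> 'rV[R]_m) z.
  by apply: linear_differentiable; exact: continuous_mulmxr.
rewrite (diffD (differentiable_cst _ _) dl).
have h1 := congr1 (fun g => g (delta_mx 0 i)) (diff_cst (c - b *m A) z).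
have h2 := congr1 (fun g => g (delta_mx 0 i)) (diff_mulmxr A z).
by transitivity (0 + (delta_mx 0 i : 'rV[R]_n) *m A); [congr (_ + _)|rewrite add0r].
Qed.

(** The affine map that replaces the [A]-component of [u] by [c] sends [u *m A] to [u] and [C] into
    [D], and its Jacobian is [A^T]; pulling [v] back along it gives [v *m A]. *)
Lemma regular_normal_proj p q (A : 'M[R]_(p, q)) (D : set 'rV[R]_p)
    (C : set 'rV[R]_q) u v :
  A^T *m A = 1%:M -> (forall y, D y -> C (y *m A)) ->
  (forall c, C c -> D (u + (c - u *m A) *m A^T)) ->
  regular_normal_cone D u v -> regular_normal_cone C (u *m A) (v *m A).
Proof.
move=> AA DC CD Nv.
pose f c := u + (c - u *m A) *m A^T.
have fu : f (u *m A) = u by rewrite /f subrr mul0mx addr0.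
rewrite -[A in v *m A]trmxK -(jacobian_affine A^T (u *m A) u (u *m A)).
apply: (@regular_normal_pullback _ _ C D f).
- exact: differentiable_affine.
- by apply: DC; case: Nv.
- by apply: (@filterE _ (nbhs (u *m A))) => c; exact: CD.
- by rewrite fu.
Qed.

Lemma dir_normal_proj p q (A : 'M[R]_(p, q)) (D : set 'rV[R]_p)
    (C : set 'rV[R]_q) z d v :
  A^T *m A = 1%:M -> (forall y, D y -> C (y *m A)) ->
  (forall u c, D u -> C c -> D (u + (c - u *m A) *m A^T)) ->
  dir_normal_cone D z d v -> dir_normal_cone C (z *m A) (d *m A) (v *m A).
Proof.
move=> AA DC CD [t [d_ [v_ [t0 tc dc vc Nv]]]].
exists t, (fun k => d_ k *m A), (fun k => v_ k *m A); split => //.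
- by apply: cvg_mulmx => //; exact: cvg_cst.
- by apply: cvg_mulmx => //; exact: cvg_cst.
- move=> k; rewrite scalemxAl -mulmxDl; apply: (regular_normal_proj AA DC _ (Nv k)) => c.
  by apply: CD; case: (Nv k).
Qed.

(** Zero is a regular normal at every point of the set. Facts on tangents thus become the case
    [v = 0] of facts on directional normals. *)
Lemma tangent_dir_normal0 p (C : set 'rV[R]_p) z u :
  tangent_cone C z u <-> dir_normal_cone C z u 0.
Proof.
split=> [[t [u_ [t0 tc uc Cu]]]|[t [u_ [v_ [t0 tc uc _ Nv]]]]]; exists t, u_.
  exists (fun=> 0); split => //; first exact: cvg_cst.
  move=> k; split => // e e0; apply: (@filterE _ (nbhs _)) => y _.
  by rewrite dotv0l mulr_ge0 ?enorm_ge0// ltW.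
by split => // k; case: (Nv k).
Qed.

End NormalCones.

(** * Error bounds from directional normals *)

Section ErrorBound.
Context {R : realType}.

(** Bolzano-Weierstrass. The index map is only required to satisfy [k <= s k], which is enough to
    carry limits over. *)
Lemma bounded_subsequence p (u : nat -> 'rV[R]_p) (M : R) :
  (forall k, `|u k| <= M) ->
  exists (s : nat -> nat) (l : 'rV[R]_p),
    (forall k, (k <= s k)%N) /\ (u \o s) @ \oo --> l.
Proof.
move=> uM; pose A := [set x : 'rV[R]_p | `|x| <= M].
have Ac : compact A.
  apply: bounded_closed_compact.
    by exists M; split => [|N MN x /= xM]; [exact: num_real|apply: le_trans xM (ltW MN)].
  rewrite -[X in closed X]/(Num.norm @^-1` [set r | r <= M]).
  by apply: preimage_closed; [move=> x _; exact: norm_continuous|exact: closed_le].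
have [|l [_ lc]] := Ac (u @ \oo) _; first by exists 0%N => // k _; exact: uM.
have h k : exists j, (k <= j)%N /\ ball l (k.+1%:R^-1) (u j).
  have [||_ [[j kj <-] bj]] := lc (u @` [set j | (k <= j)%N]) (ball l k.+1%:R^-1).
  - by exists k => // j /= kj; exists j.
  - by apply: nbhsx_ballx.
  - by exists j.
have [s hs] := choice h; exists s, l; split=> [k|]; first by case: (hs k).
apply/cvg_ballP => e e0; near=> k.
apply: (@le_ball _ _ _ k.+1%:R^-1); last by case: (hs k).
by apply: ltW; near: k; exact: near_infty_natSinv_lt (PosNum e0).
Unshelve. all: by end_near. Qed.

Lemma cvg_subsequence (T : topologicalType) (u : nat -> T) (l : T) (s : nat -> nat) :
  (forall k, (k <= s k)%N) -> u @ \oo --> l -> (u \o s) @ \oo --> l.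
Proof.
move=> ks ul; apply: cvg_comp ul => A [N _ NA]; exists N => // k /= Nk.
by apply: NA; exact: leq_trans (ks k).
Qed.

(** Squaring [|x - y| <= |x - z|] bounds twice the product of [x - y] and [z - y] by [|z - y| ^ 2],
    which is of second order. *)
Lemma projection_normal p (D : set 'rV[R]_p) x y (a : R) :
  D y -> (forall z, D z -> enorm (x - y) <= enorm (x - z)) -> 0 <= a ->
  regular_normal_cone D y (a *: (x - y)).
Proof.
move=> Dy ymin a0; split => // e e0.
have a1 : 0 < a + 1 by rewrite ltr_wpDl.
have : \forall z \near y, enorm (z - y) < e / (a + 1).
  have := @enormB_cvg0 _ _ y.
  by move/(@cvgr_lt _ _ (nbhs y)); apply; rewrite divr_gt0.
apply: filterS => z; rewrite ltr_pdivlMr// => hz Dz.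
have := ymin z Dz; rewrite -(@ler_sqr R) ?nnegrE ?enorm_ge0//.
rewrite [in leRHS](_ : x - z = (x - y) + - (z - y)); last by rewrite opprB addrA subrK.
rewrite [leRHS]sqr_enormD enormN dotvNr dotvZl.
move: (enorm_ge0 (z - y)) hz; move: (enorm (z - y)) (dotv _ _) => N d N0 hz h.
have {}h : d <= N ^+ 2 by have := sqr_ge0 N; lra.
by nra.
Qed.

(** Fermat's rule tested in the steepest descent direction [h] of [|P z - y|]: the decrease at rate
    [|h|] cannot exceed the slope [c] of the penalty. *)
Lemma fermat_enorm n p (P : 'rV[R]_n -> 'rV[R]_p) (z : 'rV[R]_n) y c :
  differentiable P z -> 0 <= c -> P z != y ->
  (forall x, enorm (P z - y) <= enorm (P x - y) + c * enorm (x - z)) ->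
  enorm ((enorm (P z - y))^-1 *: (P z - y) *m ('J P z)^T) <= c.
Proof.
move=> dP c0 Pzy zmin; set N := enorm (P z - y); set a := P z - y.
have N0 : 0 < N by rewrite enorm_gt0 subr_eq0.
set h := - (N^-1 *: a *m ('J P z)^T).
pose t k : R := k.+1%:R^-1.
have t0 k : 0 < t k by rewrite invr_gt0.
pose q k := (t k)^-1 *: (P (z + t k *: h) - P z).
have qc : q @ \oo --> h *m 'J P z.
  by apply: quotient_cvg_jacobian => //; [exact: cvg_harmonic|exact: cvg_cst].
(* [2 * t k * r k] equals [|a + t k *: q k| ^ 2 - N ^ 2 + 2 * c * N * t k * |h|], which is
   nonnegative by minimality of [z]. *)
pose r k := dotv a (q k) + t k * dotv (q k) (q k) / 2 + c * N * enorm h.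
have rc : r @ \oo --> dotv a (h *m 'J P z) +
    0 * dotv (h *m 'J P z) (h *m 'J P z) / 2 + c * N * enorm h.
  apply: cvgD; last exact: cvg_cst.
  apply: cvgD; first by apply: cvg_dotv => //; exact: cvg_cst.
  apply: cvgM; last exact: cvg_cst.
  by apply: cvgM; [exact: cvg_harmonic|exact: cvg_dotv].
have r0 k : 0 <= r k.
  have := zmin (z + t k *: h).
  have -> : P (z + t k *: h) - y = a + t k *: q k.
    by rewrite /q scalerA divff ?lt0r_neq0// scale1r [RHS]addrC /a subrKA.
  have -> : z + t k *: h - z = t k *: h by rewrite addrC addKr.
  rewrite enormZ gtr0_norm// -/a -/N => hN.
  have {hN} : N - c * (t k * enorm h) <= enorm (a + t k *: q k) by lra.
  have := sqr_enormD a (t k *: q k).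
  rewrite dotvZr (sqr_enorm (t k *: _)) dotvZr dotvZl -/N.
  rewrite -(@pmulr_rge0 _ (t k))// /r.
  have := enorm_ge0 (a + t k *: q k); have := enorm_ge0 h.
  move: (t k) (t0 k) (dotv (q k) _) (dotv a _) (enorm h) (enorm (a + _)).
  move=> T T0 Q d H S H0 S0 hS hN.
  have X0 : 0 <= c * (T * H) by rewrite !mulr_ge0// ltW.
  have : N ^+ 2 - 2 * N * (c * (T * H)) <= S ^+ 2.
    by have [neg|pos] := ltP (N - c * (T * H)) 0; nra.
  by rewrite hS; lra.
have -> : enorm (N^-1 *: a *m ('J P z)^T) = enorm h by rewrite enormN.
(* Limit of [r k >= 0]: by the choice of [h], the product of [a] with the derivative of [P] along
   [h] is [- N * |h| ^ 2]. *)
have : 0 <= - N * enorm h ^+ 2 + c * N * enorm h.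
  have : 0 <= limn r by apply: limr_ge; [exact: (cvgP _ rc)|exact: nearW].
  rewrite (cvg_lim _ rc)// !mul0r addr0 -dotv_mulmxr sqr_enorm -dotvZl.
  congr (_ <= dotv _ _ + _).
  by rewrite /h scaleNr scalerN opprK -scalemxAl scalerA divff ?lt0r_neq0// scale1r.
move: (enorm_ge0 h); move: (enorm h) => H H0 hH.
have [//|cH] := leP H c.
have : 0 <= N * (H * (c - H)) by lra.
by rewrite pmulr_rge0// pmulr_rge0 ?subr_ge0//; lra.
Qed.

(* The minimizer of [edistance D (P z) + c * enorm (z - z0)] plays the role of
   the point given by Ekeland's principle; [v] is the unit vector from a
   projection [y] of [P z] on [D] to [P z]. *)
Lemma penalized_minimizer n p (D : set 'rV[R]_p) (P : 'rV[R]_n -> 'rV[R]_p) z0 (c : R) :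
  closed D -> D !=set0 -> (forall z, differentiable P z) -> 0 < c ->
  edistance D (P z0) < c * edistance [set z | D (P z)] z0 ->
  exists z y v, [/\ regular_normal_cone D y v, enorm v = 1,
    c * enorm (z - z0) <= edistance D (P z0),
    enorm (P z - y) <= edistance D (P z0) & enorm (v *m ('J P z)^T) <= c].
Proof.
move=> Dcl D0 dP c0 hz0.
pose f z := edistance D (P z) + c * enorm (z - z0).
have fc : continuous f.
  have c1 : continuous (edistance D \o P).
    by move=> z; apply: continuous_comp;
      [exact: differentiable_continuous|exact: continuous_edistance].
  have c2 : continuous (fun z : 'rV[R]_n => enorm (z - z0)).
    move=> z; apply: (@cvg_enorm _ _ _ (nbhs z)).
    by apply: cvgB; [exact: cvg_id|exact: cvg_cst].
  move=> z; apply: (@continuousD _ _ _ (edistance D \o P)); first exact: c1.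
  by apply: (@continuousM _ _ (fun=> c)); [exact: cst_continuous|exact: c2].
have [||z _ zmin] := @coercive_argmin _ _ setT f c z0 closedT _ fc c0.
- by exists z0.
- by move=> z; rewrite /f lerDr edistance_ge0.
have fz0 : f z0 = edistance D (P z0) by rewrite /f subrr enorm0 mulr0 addr0.
have := zmin z0 I; rewrite fz0 => fz.
have [y [Dy ey ymin]] := projection (P z) Dcl D0.
have zz0 : c * enorm (z - z0) <= edistance D (P z0).
  by apply: le_trans fz; rewrite /f lerDr edistance_ge0.
(* Otherwise [z] would satisfy the constraint, and its distance to [z0] would contradict the assumed
   failure of the bound at [z0]. *)
have Pzy : P z != y.
  apply/negP => /eqP Pzy; move: hz0; rewrite ltNge => /negP; apply.
  apply: le_trans zz0; rewrite ler_pM2l// enormBC.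
  by apply: edistance_le; rewrite /= Pzy.
have N0 : 0 < enorm (P z - y) by rewrite enorm_gt0 subr_eq0.
exists z, y, ((enorm (P z - y))^-1 *: (P z - y)); split => //.
- by apply: projection_normal => //; rewrite invr_ge0 ltW.
- by rewrite enormZ gtr0_norm ?invr_gt0// mulVf ?lt0r_neq0.
- by rewrite -ey; apply: le_trans fz; rewrite /f lerDl mulr_ge0 ?enorm_ge0// ltW.
apply: fermat_enorm => //; first exact: ltW.
(* Minimality passes from the distance to [D] to the distance to the fixed point [y]: the two agree
   at [P z], and the former is no larger at [P x]. *)
move=> x; rewrite -ey; have := zmin x I; rewrite /f => h.
have := edistance_le (P x) Dy; have := enorm_triangle x z z0 => h1 h2.
have : c * enorm (x - z0) <= c * enorm (x - z) + c * enorm (z - z0).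
  by rewrite -mulrDr ler_pM2l// enorm_triangle.
by lra.
Qed.

End ErrorBound.

Section DirectionalErrorBound.
Context {R : realType}.

(** The bound with constant [1 / c ^ 2] fails at some [z0] near [zs]. Penalizing with weight [c]
    leaves one factor [c] to keep the minimizer close to [z0] relative to [|z0 - zs|], so that all
    estimates can be restated in terms of [|z - zs|]. *)
Lemma failing_error_bound_step n p (D : set 'rV[R]_p) (P : 'rV[R]_n -> 'rV[R]_p)
    zs (c : R) :
  closed D -> (forall z, differentiable P z) -> D (P zs) -> 0 < c -> c <= 1 / 2 ->
  ~ (\forall z \near zs, edistance [set z | D (P z)] z <=
       (c ^+ 2)^-1 * edistance D (P z)) ->
  exists z y v, [/\ regular_normal_cone D y v, enorm v = 1,
    0 < enorm (z - zs), enorm (z - zs) <= c &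
    enorm (P z - y) <= c * enorm (z - zs) /\ enorm (v *m ('J P z)^T) <= c].
Proof.
move=> Dcl dP Dzs c0 c2 nEB.
have D0 : D !=set0 by exists (P zs).
have [z0 [z0s hz0]] : exists z0, enorm (z0 - zs) < c / 2 /\
    (c ^+ 2)^-1 * edistance D (P z0) < edistance [set z | D (P z)] z0.
  apply: contrapT => nex; apply: nEB.
  have := @enormB_cvg0 _ _ zs.
  move/(@cvgr_lt _ _ (nbhs zs)) => /(_ (c / 2)) []; first by rewrite divr_gt0.
  move=> e e0 he; exists e => // z /he /= hz.
  by rewrite leNgt; apply/negP => hz0; apply: nex; exists z.
move: hz0; rewrite ltr_pdivrMl ?exprn_gt0// => hz0.
have hs : edistance [set z | D (P z)] z0 <= enorm (z0 - zs) by exact: edistance_le.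
have c1 : c * c <= c / 2 by nra.
have [|z [y [v [Nv v1 hz hy hv]]]] := penalized_minimizer Dcl D0 dP c0 (z0 := z0).
  apply: lt_le_trans hz0 _; rewrite ler_wpM2r ?edistance_ge0//; nra.
exists z, y, v.
move: hs hz0 hz hy z0s; set s := enorm (z0 - zs).
have := edistance_ge0 D (P z0).
set d := edistance [set _ | _] z0; set r := edistance D (P z0) => r0 ds hr hz hy s0.
(* Chain of bounds: [c * |z - z0| <= r < c ^ 2 * d <= c ^ 2 * s]. *)
have zz0 : enorm (z - z0) < c * s.
  rewrite -(ltr_pM2l c0); apply: le_lt_trans hz _; apply: lt_le_trans hr _.
  by rewrite mulrA -expr2 ler_pM2l ?exprn_gt0.
have sp : 0 < s.
  by have : 0 < c * s := le_lt_trans (enorm_ge0 _) zz0; rewrite pmulr_rgt0.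
have t1 := enorm_triangle z z0 zs; have t2 := enorm_triangle z0 z zs.
rewrite -/s in t1 t2; rewrite (enormBC z0 z) in t1.
split => //; [nra|nra|split => //].
apply: le_trans hy _.
have : c ^+ 2 * d <= c * (c * s) by rewrite expr2 -mulrA !ler_pM2l.
(* Since [s <= |z - zs| + c * s] and [c <= 1 / 2]; then [c ^ 2 * s <= c * |z - zs|]. *)
have : s <= 2 * enorm (z - zs) by nra.
by nra.
Qed.

(** First-order sufficient condition for metric subregularity of the constraint [P z] in [D]. Limits
    of the normalized directions and of the unit normals both have norm one, and together they
    violate the assumption. *)
Lemma directional_error_bound n p (D : set 'rV[R]_p) (P : 'rV[R]_n -> 'rV[R]_p) zs :
  closed D -> (forall z, differentiable P z) -> {for zs, continuous (fun z => 'J P z)} ->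
  D (P zs) ->
  (forall w, w != 0 -> tangent_cone D (P zs) (w *m 'J P zs) ->
    forall v, v *m ('J P zs)^T = 0 ->
    dir_normal_cone D (P zs) (w *m 'J P zs) v -> v = 0) ->
  exists2 kappa : R, 0 < kappa &
    \forall z \near zs, edistance [set z | D (P z)] z <= kappa * edistance D (P z).
Proof.
move=> Dcl dP cJ Dzs FOSCMS; apply: contrapT => nEB.
(* Starting at [k + 2] ensures [c k <= 1 / 2]. *)
pose c k : R := k.+2%:R^-1.
have c0 k : 0 < c k by rewrite invr_gt0.
have cc : c @ \oo --> (0 : R).
  apply: (@cvg_comp _ _ _ S (@harmonic R) _ \oo); last exact: cvg_harmonic.
  by move=> A [N _ NA]; exists N => // k /= Nk; apply: NA; exact: leqW.
have h k : exists q : 'rV[R]_n * 'rV[R]_p * 'rV[R]_p,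
    [/\ regular_normal_cone D q.1.2 q.2, enorm q.2 = 1,
    0 < enorm (q.1.1 - zs), enorm (q.1.1 - zs) <= c k &
    enorm (P q.1.1 - q.1.2) <= c k * enorm (q.1.1 - zs) /\
    enorm (q.2 *m ('J P q.1.1)^T) <= c k].
  have [||z [y [v hzyv]]] := failing_error_bound_step Dcl dP Dzs (c0 k).
  - by rewrite /c mul1r lef_pV2 ?posrE// ler_nat.
  - by move=> e; apply: nEB; exists (c k ^+ 2)^-1 => //; rewrite invr_gt0 exprn_gt0.
  - by exists (z, y, v).
have [q hq] := choice h.
pose t k := enorm ((q k).1.1 - zs).
pose w k := (t k)^-1 *: ((q k).1.1 - zs).
have t0 k : 0 < t k by case: (hq k).
have w1 k : enorm (w k) = 1.
  by rewrite enormZ gtr0_norm ?invr_gt0// mulVf// lt0r_neq0.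
(* Directions and normals are extracted along one subsequence by treating each pair as a single
   bounded vector. *)
have [|s [l [ks sl]]] := bounded_subsequence (u := fun k => row_mx (w k) (q k).2) (M := 2).
  move=> k; apply: le_trans (norm_le_enorm _) _.
  have -> : row_mx (w k) (q k).2 = row_mx (w k) 0 + row_mx 0 (q k).2.
    by rewrite add_row_mx addr0 add0r.
  apply: le_trans (enormD _ _) _.
  rewrite /enorm !dotvE !tr_row_mx !mul_row_col !(trmx0, mulmx0, mul0mx, addr0, add0r).
  by rewrite -!dotvE -/(enorm _) -/(enorm _) w1; case: (hq k) => _ -> _ _ _; lra.
pose W := lsubmx l; pose V := rsubmx l.
have wW : (w \o s) @ \oo --> W.
  apply/cvg_mxP => i j; have /cvg_mxP/(_ i (lshift p j)) := sl.
  by rewrite mxE; under eq_cvg do rewrite /= row_mxEl.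
have vV : (fun k => (q (s k)).2) @ \oo --> V.
  apply/cvg_mxP => i j; have /cvg_mxP/(_ i (rshift n j)) := sl.
  by rewrite mxE; under eq_cvg do rewrite /= row_mxEr.
have ccs : (c \o s) @ \oo --> (0 : R) by exact: cvg_subsequence.
have ts : (t \o s) @ \oo --> (0 : R).
  apply: (squeeze_cvgr _ (cvg_cst (0 : R)) ccs); apply: nearW => k /=.
  by rewrite ltW//=; case: (hq (s k)).
have nW : enorm W = 1.
  have h1 : (fun k => enorm ((w \o s) k)) @ \oo --> (1 : R).
    by under eq_cvg do rewrite /= w1; exact: cvg_cst.
  exact: (cvg_unique _ (cvg_enorm _ wW) h1).
have nV : enorm V = 1.
  have h1 : (fun k => enorm (q (s k)).2) @ \oo --> (1 : R).
    under eq_cvg => k do [have -> : enorm (q (s k)).2 = 1 by case: (hq (s k))].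
    exact: cvg_cst.
  exact: (cvg_unique _ (cvg_enorm _ vV) h1).
have zE k : (q k).1.1 = zs + t k *: w k.
  by rewrite scalerA divff ?lt0r_neq0// scale1r addrC subrK.
have zc : (fun k => (q (s k)).1.1) @ \oo --> zs.
  have -> : (fun k => (q (s k)).1.1) = fun k => zs + t (s k) *: w (s k).
    by apply/funext => k; exact: zE.
  rewrite -[X in _ --> X]addr0 -[X in _ + X](scale0r W).
  by apply: cvgD; [exact: cvg_cst|exact: cvgZ].
(* Direction of the projected point seen from [P zs]. That point is within [c k * t k] of the value
   of [P], so [d k] has the same limit as the difference quotient of [P]. *)
pose d k := (t k)^-1 *: ((q k).1.2 - P zs).
have dE k : (q k).1.2 = P zs + t k *: d k.
  by rewrite scalerA divff ?lt0r_neq0// scale1r addrC subrK.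
have dc : (d \o s) @ \oo --> W *m 'J P zs.
  have Pq : (fun k => (t (s k))^-1 *: (P (zs + t (s k) *: w (s k)) - P zs)) @ \oo -->
      W *m 'J P zs by exact: quotient_cvg_jacobian.
  rewrite -[X in _ --> X]subr0.
  have -> : d \o s = fun k => (t (s k))^-1 *: (P (zs + t (s k) *: w (s k)) - P zs) -
     (t (s k))^-1 *: (P (q (s k)).1.1 - (q (s k)).1.2).
    by apply/funext => k; rewrite -zE -scalerBr opprB [X in _ *: X]addrC subrKA.
  apply: cvgB => //; apply: enorm_cvg0.
  apply: (squeeze_cvgr _ (cvg_cst (0 : R)) ccs); apply: nearW => k /=.
  rewrite enorm_ge0 enormZ gtr0_norm ?invr_gt0//= ler_pdivrMl// mulrC.
  by case: (hq (s k)) => _ _ _ _ [].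
have NV : dir_normal_cone D (P zs) (W *m 'J P zs) V.
  exists (t \o s), (d \o s), (fun k => (q (s k)).2); split => // k.
    exact: t0.
  by rewrite -dE; case: (hq (s k)).
have VJ : V *m ('J P zs)^T = 0.
  have h1 : (fun k => (q (s k)).2 *m ('J P (q (s k)).1.1)^T) @ \oo --> V *m ('J P zs)^T.
    by apply: cvg_mulmx => //; apply: cvg_trmx; exact: (cvg_comp _ _ zc cJ).
  have h2 : (fun k => (q (s k)).2 *m ('J P (q (s k)).1.1)^T) @ \oo --> (0 : 'rV[R]_n).
    apply: enorm_cvg0; apply: (squeeze_cvgr _ (cvg_cst (0 : R)) ccs).
    by apply: nearW => k /=; rewrite enorm_ge0 /=; case: (hq (s k)) => _ _ _ _ [].
  exact: (cvg_unique _ h1 h2).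
have W0 : W != 0 by rewrite -enorm_gt0 nW.
suff : V = 0 by move=> V0; move: nV; rewrite V0 enorm0; lra.
(* The projected points lie in [D], so they also witness that the image of [W] is tangent. *)
apply: (FOSCMS W) => //; exists (t \o s), (d \o s); split => // k; first exact: t0.
by rewrite -dE; case: (hq (s k)) => -[].
Qed.

End DirectionalErrorBound.

(** * Directional normals in conic charts *)

Section ConicCharts.
Context {R : realType}.

Definition C1_at n m (f : 'rV[R]_n -> 'rV[R]_m) z :=
  (\forall y \near z, differentiable f y) /\ {for z, continuous (fun y => 'J f y)}.

(* Unlike in [dir_normal_cone], the step sizes are prescribed: this is what
   allows directional normals to different factors to be combined. *)
Definition dir_normal_stable p (C : set 'rV[R]_p) z :=
  forall d v, dir_normal_cone C z d v ->
  forall t : nat -> R, (forall k, 0 < t k) -> t @ \oo --> (0 : R) ->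
  exists d_ v_ : nat -> 'rV[R]_p, [/\ d_ @ \oo --> d, v_ @ \oo --> v &
    \forall k \near \oo, regular_normal_cone C (z + t k *: d_ k) (v_ k)].

Lemma regular_normalZ p (C : set 'rV[R]_p) z v (a : R) :
  0 < a -> regular_normal_cone C z v -> regular_normal_cone C z (a *: v).
Proof.
move=> a0 [Cz Nv]; split => // e e0.
have := Nv _ (divr_gt0 e0 a0); apply: filterS => y h /h.
by rewrite dotvZl mulrAC ler_pdivlMr// mulrC.
Qed.

Lemma jacobian_id n (z : 'rV[R]_n) : 'J (@id 'rV[R]_n) z = 1%:M.
Proof.
apply/row_matrixP => i; rewrite !rowE mulmx_jacobian mulmx1.
by have /(congr1 (fun g => g (delta_mx 0 i))) := @diff_val _ _ _ _ _ _ _ (is_diff_id z).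
Qed.

(* If [C] is a cone with apex [Phi z] in the coordinates [Phi], then
   [Gam (Phi z + (t / t') *: (Phi y - Phi z))] maps [C] into itself near the point
   with step [t'] and moves it to the given point with step [t]; normals are
   pulled back along it. *)
Lemma conic_chart_dir_normal_stable p (C : set 'rV[R]_p) z
    (Phi Gam : 'rV[R]_p -> 'rV[R]_p) (delta : R) :
  C1_at Phi z -> C1_at Gam (Phi z) -> cancel Phi Gam -> cancel Gam Phi ->
  0 < delta ->
  (forall e (a : R), 0 < a -> `|e| < delta -> `|a *: e| < delta ->
    C (Gam (Phi z + e)) -> C (Gam (Phi z + a *: e))) ->
  dir_normal_stable C z.
Proof.
move=> [dPhi cPhi] [dGam cGam] PhiK GamK delta0 Cconic d v.
move=> [t [d_ [v_ [t0 tc dc vc Nv]]]] t' t'0 t'c.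
set Z := Phi z.
have dPz : differentiable Phi z := nbhs_singleton dPhi.
have dGZ : differentiable Gam Z := nbhs_singleton dGam.
pose zk k := z + t k *: d_ k.
have zkc : zk @ \oo --> z.
  rewrite -[X in _ --> X]addr0 -[X in _ + X](scale0r d).
  by apply: cvgD; [exact: cvg_cst|exact: cvgZ].
(* In the chart the direction [e k] of the given point is kept, and only the step along it changes
   from [t k] to [t' k]. *)
pose e k := (t k)^-1 *: (Phi (zk k) - Z).
have ec : e @ \oo --> d *m 'J Phi z by exact: quotient_cvg_jacobian.
pose Y k := Z + t' k *: e k.
have Yc : Y @ \oo --> Z.
  rewrite -[X in _ --> X]addr0 -[X in _ + X](scale0r (d *m 'J Phi z)).
  by apply: cvgD; [exact: cvg_cst|exact: cvgZ].
pose z' k := Gam (Y k).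
have PhiZ : Gam Z = z by exact: PhiK.
have z'c : z' @ \oo --> z.
  have GZ : Gam @ Z --> Gam Z := differentiable_continuous dGZ.
  by rewrite -[X in _ --> X]PhiZ; exact: (cvg_comp _ _ Yc GZ).
have Pzk : (Phi \o zk) @ \oo --> Z.
  exact: (cvg_comp _ _ zkc (differentiable_continuous dPz)).
(* Because of this identity the new directions and normals converge to the same [d] and [v]. *)
have JJ : 'J Phi z *m 'J Gam Z = 1%:M.
  rewrite -jacobian_comp// -(jacobian_id z); congr ('J _ z).
  by apply/funext => y /=; rewrite PhiK.
pose d' k := (t' k)^-1 *: (z' k - z).
(* Pullback of [v_ k] along the map taking [z' k] to [zk k], multiplied by [t' k / t k] to cancel
   the ratio of the homothety. *)
pose v' k := v_ k *m ('J Phi (z' k) *m 'J Gam (Phi (zk k)))^T.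
exists d', v'; split.
- have := quotient_cvg_jacobian eventually_filter dGZ t'0 t'c ec.
  by rewrite -mulmxA JJ mulmx1 PhiZ.
- rewrite -[X in _ --> X]mulmx1 -trmx1 -JJ.
  apply: cvg_mulmx => //; apply: cvg_trmx; apply: cvg_mulmx.
    exact: (cvg_comp _ _ z'c cPhi).
  exact: (cvg_comp _ _ Pzk cGam).
have te k : t k *: e k = Phi (zk k) - Z.
  by rewrite scalerA divff ?lt0r_neq0// scale1r.
have tec : (fun k => t k *: e k) @ \oo --> (0 : 'rV[R]_p).
  by rewrite -(scale0r (d *m 'J Phi z)); exact: cvgZ.
have t'ec : (fun k => t' k *: e k) @ \oo --> (0 : 'rV[R]_p).
  by rewrite -(scale0r (d *m 'J Phi z)); exact: cvgZ.
have tes : \forall k \near \oo, `|t k *: e k| < delta.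
  by move/cvgr0Pnorm_lt: tec; exact.
have t'es : \forall k \near \oo, `|t' k *: e k| < delta.
  by move/cvgr0Pnorm_lt: t'ec; exact.
have dPz' : \forall k \near \oo, differentiable Phi (z' k) := z'c _ dPhi.
have dGzk : \forall k \near \oo, differentiable Gam (Phi (zk k)) :=
  Pzk _ dGam.
near=> k.
have -> : z + t' k *: d' k = z' k.
  by rewrite scalerA divff ?lt0r_neq0// scale1r addrC subrK.
have dPk : differentiable Phi (z' k) by near: k.
have dGk : differentiable Gam (Phi (zk k)) by near: k.
have tek : `|t k *: e k| < delta by near: k.
have t'ek : `|t' k *: e k| < delta by near: k.
set a := t k / t' k.
have a0 : 0 < a by rewrite divr_gt0.
pose A y := Z + (y - Z) *m a%:M.
have AY : A (Phi (z' k)) = Phi (zk k).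
  rewrite /A /z' GamK /Y [Z + _ - Z]addrC addKr mul_mx_scalar scalerA.
  by rewrite divfK ?lt0r_neq0// te addrC subrK.
have dA y : differentiable A y by exact: differentiable_affine.
have dAP : differentiable (A \o Phi) (z' k) by exact: differentiable_comp.
have -> : v' k = a^-1 *: (v_ k *m ('J (Gam \o (A \o Phi)) (z' k))^T).
  rewrite jacobian_comp//=; last by rewrite AY.
  rewrite jacobian_comp// AY jacobian_affine mul_mx_scalar -scalemxAl linearZ /=.
  by rewrite -scalemxAr scalerA mulVf ?lt0r_neq0// scale1r.
apply: regular_normalZ; first by rewrite invr_gt0.
apply: (@regular_normal_pullback _ _ _ C C (Gam \o (A \o Phi))).
- by apply: differentiable_comp => //=; rewrite AY.
(* The cone property is used twice: with ratio [a^-1] to place [z' k] in [C], and with ratio [a] to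
   send points of [C] near [z' k] into [C]. *)
- rewrite /z' /Y.
  have ate : a^-1 *: (t k *: e k) = t' k *: e k.
    by rewrite scalerA invf_div divfK ?lt0r_neq0.
  rewrite -ate; apply: Cconic; rewrite ?ate ?invr_gt0//.
  by rewrite te addrC subrK PhiK; case: (Nv k).
- have c1 : {for z' k, continuous (fun y => Phi y - Z)}.
    by apply: differentiable_continuous; exact: differentiableB.
  have c2 : {for z' k, continuous (fun y => a *: (Phi y - Z))}.
    by apply: differentiable_continuous; apply: differentiableZ; exact: differentiableB.
  have e1 : Phi (z' k) - Z = t' k *: e k by rewrite /z' GamK /Y addrC addKr.
  have e2 : a *: (Phi (z' k) - Z) = t k *: e k.
    by rewrite e1 scalerA divfK ?lt0r_neq0.
  have n1 : \forall y \near z' k, `|Phi y - Z| < delta.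
    by apply: (@cvgr_norm_lt _ _ _ (nbhs (z' k)) _ _ _ c1); rewrite e1.
  have n2 : \forall y \near z' k, `|a *: (Phi y - Z)| < delta.
    by apply: (@cvgr_norm_lt _ _ _ (nbhs (z' k)) _ _ _ c2); rewrite e2.
  apply: filterS2 n1 n2 => y h1 h2 Cy /=; rewrite /A mul_mx_scalar.
  by apply: Cconic => //; rewrite addrC subrK PhiK.
- by rewrite /= AY PhiK; exact: Nv.
Unshelve. all: by end_near. Qed.

End ConicCharts.

(** * Calculus of continuously differentiable real functions *)

Lemma is_diff_coord (R : realType) n (j : 'I_n) (z : 'rV[R]_n) :
  is_diff z (fun x : 'rV[R]_n => x 0 j) (fun x => x 0 j).
Proof.
pose g (x : 'rV[R]_n) := x 0 j.
have glin : linear g by move=> a x y; rewrite /g !mxE.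
pose gM := GRing.isLinear.Build _ _ _ _ _ glin.
pose gL : {linear 'rV[R]_n -> R} := HB.pack g gM.
apply: DiffDef; first exact: differentiable_coord.
by apply: (@diff_lin _ _ _ gL); exact: coord_continuous.
Qed.

Section C1Calculus.
Context {R : realType} {n : nat}.
Implicit Types (f g : 'rV[R]_n -> R) (z : 'rV[R]_n).

(** The differential is carried as a witness, and its continuity is asked for each direction [h]
    separately: this is stable under sums, products and compositions, and it gives the entries of
    the Jacobian. *)
Definition C1s_at f z := exists D : 'rV[R]_n -> 'rV[R]_n -> R,
  (\forall y \near z, is_diff y f (D y)) /\
  forall h, {for z, continuous (fun y => D y h)}.

Lemma C1s_continuous f z : C1s_at f z -> {for z, continuous f}.
Proof.
move=> [D [Df _]]; apply: differentiable_continuous.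
by have := nbhs_singleton Df; case.
Qed.

Lemma C1s_cst (c : R) z : C1s_at (fun=> c) z.
Proof.
exists (fun _ => 0); split=> [|h]; last exact: cst_continuous.
by apply: (@filterE _ (nbhs z)) => y; exact: is_diff_cst.
Qed.

Lemma C1s_coord j z : C1s_at (fun x => x 0 j) z.
Proof.
exists (fun _ h => h 0 j); split=> [|h]; last exact: cst_continuous.
by apply: (@filterE _ (nbhs z)) => y; exact: is_diff_coord.
Qed.

Lemma C1s_add f g z : C1s_at f z -> C1s_at g z -> C1s_at (fun x => f x + g x) z.
Proof.
move=> [Df [df cf]] [Dg [dg cg]]; exists (fun y => Df y + Dg y); split=> [|h].
  by apply: filterS2 df dg => y df dg; exact: is_diffD.
by apply: continuousD; [exact: cf|exact: cg].
Qed.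

Lemma C1s_mul f g z : C1s_at f z -> C1s_at g z -> C1s_at (fun x => f x * g x) z.
Proof.
move=> Cf Cg; have fz := C1s_continuous Cf; have gz := C1s_continuous Cg.
move: Cf Cg => [Df [df cf]] [Dg [dg cg]].
exists (fun y => f y *: Dg y + g y *: Df y); split=> [|h].
  by apply: filterS2 df dg => y df dg; exact: is_diffM.
by apply: continuousD; apply: continuousM.
Qed.

Lemma C1s_sum (I : Type) (r : seq I) (f : I -> 'rV[R]_n -> R) z :
  (forall i, C1s_at (f i) z) -> C1s_at (fun x => \sum_(i <- r) f i x) z.
Proof.
move=> Cf; elim: r => [|i r IH].
  by under eq_fun do rewrite big_nil; exact: C1s_cst.
by under eq_fun do rewrite big_cons; exact: C1s_add.
Qed.

Lemma C1s_comp f (g dg : R -> R) z : C1s_at f z ->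
  (\forall r \near f z, is_derive (r : R) (1 : R) g (dg r)) -> {for f z, continuous dg} ->
  C1s_at (g \o f) z.
Proof.
move=> Cf hg cdg; have fz := C1s_continuous Cf.
move: Cf => [Df [df cf]]; exists (fun y h => Df y h * dg (f y)); split=> [|h].
  apply: filterS2 df (fz _ hg) => y dfy /= dgy.
  have dg1 : is_diff (f y) g (fun h => h * dg (f y)).
    have [d1 d2] := dgy; apply: DiffDef; first exact/derivable1_diffP.
    by rewrite deriv1E// derive1E d2.
  exact: is_diff_comp.
apply: continuousM; first exact: cf.
by apply: continuous_comp => //.
Qed.

Lemma C1s_inv f z : C1s_at f z -> 0 < f z -> C1s_at (fun x => (f x)^-1) z.
Proof.
move=> Cf fz0; apply: (@C1s_comp f (fun r => r^-1) (fun r => - r ^- 2)) => //.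
  have := lt_nbhsr fz0; apply: filterS => r /lt0r_neq0 r0.
  apply: DeriveDef; first by apply: derivableV.
  by rewrite deriveV// derive_id [LHS]mulr1.
apply: continuousN; apply: continuousV; first by rewrite expf_neq0 ?lt0r_neq0.
exact: exprn_continuous.
Qed.

Lemma C1s_sqrt f z : C1s_at f z -> 0 < f z -> C1s_at (fun x => Num.sqrt (f x)) z.
Proof.
move=> Cf fz0; apply: (C1s_comp (dg := fun r => (2 * Num.sqrt r)^-1) Cf).
  by have := lt_nbhsr fz0; apply: filterS => r r0; exact: is_derive1_sqrt.
apply: continuousV; first by rewrite mulf_neq0// sqrtr_eq0 -ltNge.
by apply: continuousM; [exact: cst_continuous|exact: sqrt_continuous].
Qed.

(** The Jacobian entry [(i, j)] is the differential of coordinate [j] in the [i]-th basis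
    direction. *)
Lemma C1_at_coord m (f : 'rV[R]_n -> 'rV[R]_m) z :
  (forall j, C1s_at (fun x => f x 0 j) z) -> C1_at f z.
Proof.
move=> /choice[D hD].
have Dnear : \forall y \near z, forall j, is_diff y (fun x => f x 0 j) (D j y).
  by apply: (@filter_forall _ _ _ (nbhs z)) => j; case: (hD j).
have dnear : \forall y \near z, differentiable f y.
  apply: filterS Dnear => y hy.
  have -> : f = \sum_(j < m) (fun x => f x 0 j *: delta_mx 0 j).
    by apply/funext => x; rewrite fct_sumE [LHS]row_sum_delta.
  by apply: differentiable_sum => j; apply: differentiableZl; case: (hy j).
split => //; apply/(@cvg_mxP _ _ (nbhs z)) => i j.
have h : \forall y \near z, D j y (delta_mx 0 i) = 'J f y i j.
  apply: filterS2 Dnear dnear => y hy dy.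
  have [_ <-] := hy j.
  rewrite (@diff_comp _ _ _ _ f (fun x => x 0 j))//.
    have [_ ->] := is_diff_coord j (f y).
    by rewrite mxE.
  exact: differentiable_coord.
have [_ /(_ (delta_mx 0 i)) Dc] := hD j.
have hz := nbhs_singleton h.
have Jc : (fun y => 'J f y i j) @ z --> D j z (delta_mx 0 i).
  exact: cvg_trans (near_eq_cvg h) Dc.
exact: (eq_ind _ (fun r => (fun y => 'J f y i j) @ z --> r) Jc _ hz).
Qed.

End C1Calculus.

(** * The second-order cone complementarity set *)

Section SecondOrderCone.
Context {R : realType} {k : nat}.
Implicit Types (x y : 'rV[R]_k.+1) (z : 'rV[R]_(k.+1 + k.+1)).

(* [tl x] is [col' 0 x] padded with a leading zero. *)
Definition tl x : 'rV[R]_k.+1 := x - x 0 0 *: delta_mx 0 0.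

Lemma tl00 x : tl x 0 0 = 0.
Proof. by rewrite !mxE !eqxx mulr1 subrr. Qed.

Lemma tlS x (j : 'I_k.+1) : j != 0 -> tl x 0 j = x 0 j.
Proof. by move=> j0; rewrite !mxE (negPf j0) mulr0 subr0. Qed.

Lemma tlD x y : tl (x + y) = tl x + tl y.
Proof. by rewrite /tl mxE scalerDl opprD addrACA. Qed.

Lemma tlZ (a : R) x : tl (a *: x) = a *: tl x.
Proof. by rewrite /tl mxE scalerBr scalerA. Qed.

Lemma tlN x : tl (- x) = - tl x.
Proof. by rewrite -scaleN1r tlZ scaleN1r. Qed.

Lemma tl_tl x : tl (tl x) = tl x.
Proof. by rewrite {1}/tl tl00 scale0r subr0. Qed.

Lemma tl_delta : tl (delta_mx 0 0) = 0.
Proof. by rewrite /tl mxE !eqxx scale1r subrr. Qed.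

Lemma dotv_tl x y : dotv x y = x 0 0 * y 0 0 + dotv (tl x) (tl y).
Proof.
rewrite /dotv !big_ord_recl tl00 mul0r add0r; congr (_ + _).
by apply: eq_bigr => j _; rewrite !tlS.
Qed.

Lemma dotv_col' x y : dotv (col' 0 x) (col' 0 y) = dotv (tl x) (tl y).
Proof.
rewrite [RHS]/dotv big_ord_recl tl00 mul0r add0r; apply: eq_bigr => j _.
by rewrite ![col' _ _ _ _]mxE !tlS.
Qed.

Lemma socE x : soc x = (enorm (tl x) <= x 0 0) :> Prop.
Proof. by rewrite /soc /= /enorm dotv_col'. Qed.

(** Cauchy-Schwarz on the tails: [x_1 y_1] dominates [|x_2| |y_2|]. *)
Lemma soc_dotv_ge0 x y : soc x -> soc y -> 0 <= dotv x y.
Proof.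
rewrite !socE dotv_tl => hx hy.
have := dotv_le (- tl x) (tl y); rewrite dotvNl enormN.
have := enorm_ge0 (tl x); have := enorm_ge0 (tl y).
move: (enorm _) (enorm _) hx hy => a b; nra.
Qed.

Lemma tl_cvg (T : Type) (F : set_system T) (FF : Filter F)
    (f : T -> 'rV[R]_k.+1) (x : 'rV[R]_k.+1) :
  f @ F --> x -> (fun t => tl (f t)) @ F --> tl x.
Proof.
move=> fx; apply: cvgB => //; apply: cvgZ; last exact: cvg_cst.
by move/cvg_mxP : fx; exact.
Qed.

Lemma closed_soc : closed (@soc R k).
Proof.
have -> : @soc R k = (fun x => enorm (tl x) - x 0 0) @^-1` [set r : R | r <= 0].
  by apply/funext => x; rewrite socE /preimage /= subr_le0.
apply: preimage_closed; last exact: closed_le.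
move=> x _; apply: (@continuousB _ _ _ (fun x => enorm (tl x))).
  by apply: (@cvg_enorm _ _ _ (nbhs x)); apply: (@tl_cvg _ (nbhs x)); exact: cvg_id.
exact: coord_continuous.
Qed.

Lemma closed_compl_set p (K : set 'rV[R]_p) : closed K -> closed (compl_set K).
Proof.
move=> Kcl.
have -> : compl_set K = (lsubmx @^-1` K) `&` (rsubmx @^-1` K) `&`
    ((fun u : 'rV[R]_(p + p) => dotv (lsubmx u) (rsubmx u)) @^-1` [set r : R | r = 0]).
  by apply/seteqP; split => u /=; [move=> []|move=> [[]]].
have lc : continuous (lsubmx : 'rV[R]_(p + p) -> 'rV[R]_p).
  by move=> u; apply: differentiable_continuous; exact: differentiable_lsubmx.
have rc : continuous (rsubmx : 'rV[R]_(p + p) -> 'rV[R]_p).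
  by move=> u; apply: differentiable_continuous; exact: differentiable_rsubmx.
apply: closedI; first apply: closedI.
- by apply: preimage_closed => // u _; exact: lc.
- by apply: preimage_closed => // u _; exact: rc.
- apply: preimage_closed; last exact: closed_eq.
  by move=> u _; apply: (@cvg_dotv _ _ _ (nbhs u)); [exact: lc|exact: rc].
Qed.

(* The shear depends only on coordinates that it leaves unchanged, so that the
   inverse of [z + s *: soc_shear z] is [z - s *: soc_shear z]. *)
Definition soc_shear z : 'rV[R]_(k.+1 + k.+1) :=
  row_mx (enorm (tl (lsubmx z)) *: delta_mx 0 0)
         (- (rsubmx z 0 0 / enorm (tl (lsubmx z))) *: tl (lsubmx z)).

(** With [s = -1] these are the coordinates [x_1 - |x_2|], [x_2], [y_1], [y_2 + y_1 x_2 / |x_2|];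
    [s = 1] is the inverse map. As [0^-1 = 0], the shear vanishes where [x_2 = 0], and the two maps
    are inverse to each other on the whole space. *)
Definition soc_chart (s : R) z := z + s *: soc_shear z.

Lemma lsubmx_chart s z :
  lsubmx (soc_chart s z) = lsubmx z + (s * enorm (tl (lsubmx z))) *: delta_mx 0 0.
Proof. by rewrite /soc_chart linearD /= linearZ /= row_mxKl scalerA. Qed.

Lemma rsubmx_chart s z : rsubmx (soc_chart s z) =
  rsubmx z - (s * (rsubmx z 0 0 / enorm (tl (lsubmx z)))) *: tl (lsubmx z).
Proof. by rewrite /soc_chart linearD /= linearZ /= row_mxKr scalerA mulrN scaleNr. Qed.

Lemma tl_lsubmx_chart s z : tl (lsubmx (soc_chart s z)) = tl (lsubmx z).
Proof. by rewrite lsubmx_chart tlD tlZ tl_delta scaler0 addr0. Qed.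

Lemma lsubmx_chart00 s z :
  lsubmx (soc_chart s z) 0 0 = lsubmx z 0 0 + s * enorm (tl (lsubmx z)).
Proof. by rewrite lsubmx_chart mxE [X in _ + X]mxE [delta_mx _ _ _ _]mxE mulr1. Qed.

Lemma rsubmx_chart00 s z : rsubmx (soc_chart s z) 0 0 = rsubmx z 0 0.
Proof.
by rewrite rsubmx_chart mxE [X in _ + X]mxE [X in - X]mxE tl00 mulr0 subr0.
Qed.

Lemma shear_chart s z : soc_shear (soc_chart s z) = soc_shear z.
Proof.
by rewrite /soc_shear tl_lsubmx_chart rsubmx_chart00.
Qed.

Lemma chartK s : cancel (soc_chart s) (soc_chart (- s)).
Proof. by move=> z; rewrite {1}/soc_chart shear_chart scaleNr addrK. Qed.

Lemma C1_at_chart s z : tl (lsubmx z) != 0 -> C1_at (soc_chart s) z.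
Proof.
rewrite -enorm_gt0 => tz.
have Ctl (j : 'I_k.+1) : C1s_at (fun x : 'rV[R]_(k.+1 + k.+1) => tl (lsubmx x) 0 j) z.
  have [->|j0] := eqVneq j 0; first by under eq_fun do rewrite tl00; exact: C1s_cst.
  by under eq_fun do rewrite tlS// mxE; exact: C1s_coord.
have Cnu : C1s_at (fun x : 'rV[R]_(k.+1 + k.+1) => enorm (tl (lsubmx x))) z.
  apply: (@C1s_sqrt _ _
    (fun x : 'rV[R]_(k.+1 + k.+1) => dotv (tl (lsubmx x)) (tl (lsubmx x)))).
    by apply: C1s_sum => j; exact: C1s_mul.
  by rewrite -sqr_enorm exprn_gt0.
have Cy : C1s_at (fun x : 'rV[R]_(k.+1 + k.+1) => rsubmx x 0 0) z.
  by under eq_fun do rewrite mxE; exact: C1s_coord.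
have Cinv : C1s_at (fun x : 'rV[R]_(k.+1 + k.+1) => (enorm (tl (lsubmx x)))^-1) z.
  exact: C1s_inv.
apply: C1_at_coord => j; rewrite /soc_chart.
under eq_fun do rewrite mxE [X in _ + X]mxE.
apply: C1s_add; first exact: C1s_coord.
apply: C1s_mul; first exact: C1s_cst.
case: (split_ordP j) => {}j ->.
  under eq_fun do rewrite /soc_shear row_mxEl mxE.
  by apply: C1s_mul => //; exact: C1s_cst.
under eq_fun do rewrite /soc_shear row_mxEr mxE -mulN1r.
apply: C1s_mul => //; apply: C1s_mul; first exact: C1s_cst.
exact: C1s_mul.
Qed.

(** Write [X], [Y] for the two halves of [z]. Orthogonality becomes [X_1 Y_1 + <X_2, Y_2> = 0], so
    [<X_2, Y_2> <= 0]; the cone condition on the second half then gives [|Y_2| ^ 2 <= 2 (Y_1 /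
    |X_2|) <X_2, Y_2> <= 0]. The resulting description no longer involves [X_2] and is homogeneous
    in the other coordinates. *)
Lemma compl_soc_chart z : tl (lsubmx z) != 0 ->
  compl_set soc (soc_chart 1 z) <->
  [/\ 0 <= lsubmx z 0 0, 0 <= rsubmx z 0 0,
      lsubmx z 0 0 * rsubmx z 0 0 = 0 & tl (rsubmx z) = 0].
Proof.
rewrite -enorm_gt0; have := tl_lsubmx_chart 1 z; rewrite /compl_set /=.
rewrite !socE dotv_tl lsubmx_chart00 rsubmx_chart00 => ->.
rewrite rsubmx_chart !mul1r tlD tlN tlZ tl_tl.
set X := lsubmx z; set Y := rsubmx z; set nu := enorm (tl X) => nu0.
rewrite (dotvDr (tl Y)) dotvNr (dotvZr _ (tl X)) -sqr_enorm -/nu.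
have -> : X 0 0 + nu >= nu = (0 <= X 0 0) by rewrite lerDr.
have eY : enorm (tl Y - (Y 0 0 / nu) *: tl X) ^+ 2 =
   enorm (tl Y) ^+ 2 - (Y 0 0 / nu * dotv (tl X) (tl Y)) *+ 2 + Y 0 0 ^+ 2.
  rewrite sqr_enormD enormN dotvNr dotvZr dotvC enormZ exprMn real_normK ?num_real//.
  by rewrite -/nu exprMn exprVn divfK ?expf_neq0 ?lt0r_neq0// mulNrn.
have yn : Y 0 0 / nu * nu ^+ 2 = Y 0 0 * nu by rewrite expr2 mulrA divfK ?lt0r_neq0.
rewrite yn; split.
- move=> [X0 hY dXY].
  have Y0 : 0 <= Y 0 0 := le_trans (enorm_ge0 _) hY.
  have d0 : dotv (tl X) (tl Y) <= 0 by nra.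
  have t0 : 0 <= Y 0 0 / nu by rewrite divr_ge0// ltW.
  have : enorm (tl Y) ^+ 2 <= 0.
    move: hY; rewrite -(@ler_sqr R) ?nnegrE ?enorm_ge0// eY.
    have : Y 0 0 / nu * dotv (tl X) (tl Y) <= 0 by nra.
    by lra.
  rewrite sqr_enorm => h.
  have tY : tl Y = 0 by apply/eqP; rewrite -dotv_eq0 eq_le h dotv_ge0.
  by move: dXY; rewrite tY dotvC dotv0l; split => //; nra.
- move=> [X0 Y0 XY tY]; split => //.
    have c0 : 0 <= Y 0 0 / nu by rewrite divr_ge0// ltW.
    by rewrite tY add0r enormN enormZ (ger0_norm c0) -/nu divfK ?lt0r_neq0.
  by rewrite tY dotvC dotv0l; nra.
Qed.

End SecondOrderCone.

(** * Prescribed step sizes for the complementarity set of one cone *)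

Section Stability.
Context {R : realType}.

Lemma conic_dir_normal_stable p (C : set 'rV[R]_p) z (delta : R) : 0 < delta ->
  (forall e (a : R), 0 < a -> `|e| < delta -> `|a *: e| < delta ->
    C (z + e) -> C (z + a *: e)) ->
  dir_normal_stable C z.
Proof.
have Cid : C1_at (@id 'rV[R]_p) z.
  split; first by apply: (@filterE _ (nbhs z)) => y.
  have -> : (fun y => 'J (@id 'rV[R]_p) y) = fun=> 1%:M.
    by apply/funext => y; exact: jacobian_id.
  exact: cst_continuous.
by move=> d0 h; exact: (conic_chart_dir_normal_stable Cid Cid _ _ d0).
Qed.

(** Sequences are transported by an orthogonal symmetry of [C] and back. Its use is the exchange of
    [x] and [y]. *)
Lemma dir_normal_stable_iso p (C : set 'rV[R]_p) (A : 'M[R]_p) z :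
  A *m A^T = 1%:M -> A^T *m A = 1%:M ->
  (forall y, C y -> C (y *m A)) -> (forall y, C y -> C (y *m A^T)) ->
  dir_normal_stable C (z *m A) -> dir_normal_stable C z.
Proof.
move=> AA AtA CA CAt st d v Nv t t0 tc.
have repl u c : C u -> C c -> C (u + (c - u *m A) *m A^T).
  by move=> _ Cc; rewrite mulmxBl -mulmxA AA mulmx1 addrC subrK; exact: CAt.
have [d' [v' [dc vc N']]] := st _ _ (dir_normal_proj AtA CA repl Nv) t t0 tc.
exists (fun k => d' k *m A^T), (fun k => v' k *m A^T); split.
- rewrite -[X in _ --> X]mulmx1 -AA mulmxA.
  by apply: cvg_mulmx => //; exact: cvg_cst.
- rewrite -[X in _ --> X]mulmx1 -AA mulmxA.
  by apply: cvg_mulmx => //; exact: cvg_cst.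
apply: filterS N' => k Nk.
have -> : z + t k *: (d' k *m A^T) = (z *m A + t k *: d' k) *m A^T.
  by rewrite mulmxDl -mulmxA AA mulmx1 -scalemxAl.
apply: (regular_normal_proj _ CAt _ Nk); first by rewrite trmxK.
move=> c Cc; rewrite trmxK mulmxBl -mulmxA AtA mulmx1 addrC subrK; exact: CA.
Qed.

Variable k : nat.
Implicit Types (x y : 'rV[R]_k.+1) (z : 'rV[R]_(k.+1 + k.+1)).
Local Notation Om := (@compl_set R k.+1 soc).

Lemma tl_eq0 x : tl x = 0 -> x 0 0 = 0 -> x = 0.
Proof. by rewrite /tl => /eqP; rewrite subr_eq0 => /eqP xE x0; rewrite xE x0 scale0r. Qed.

(** By Cauchy-Schwarz, [0 = <x, y> >= (x_1 - |x_2|) y_1], which forces [y_1 = 0]. *)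
Lemma soc_interior_orthogonal x y : enorm (tl x) < x 0 0 -> soc y ->
  dotv x y = 0 -> y = 0.
Proof.
rewrite socE dotv_tl => hx hy.
have := dotv_le (- tl x) (tl y); rewrite dotvNl enormN => h1 h2.
have x0 := enorm_ge0 (tl x); have y0 := enorm_ge0 (tl y).
have y00 : y 0 0 = 0 by nra.
have ty : tl y = 0 by apply/eqP; rewrite -enorm_eq0; apply/eqP; lra.
exact: tl_eq0.
Qed.

Lemma soc_scale (a : R) x : 0 <= a -> soc x -> soc (a *: x).
Proof. by move=> a0; rewrite !socE tlZ enormZ ger0_norm// mxE => ?; rewrite ler_wpM2l. Qed.

Lemma stable_compl_soc_origin : dir_normal_stable Om 0.
Proof.
apply: (@conic_dir_normal_stable _ _ _ 1) => // e a a0 _ _; rewrite !add0r.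
move=> [h1 h2 h3]; split; rewrite !linearZ /=.
- exact: soc_scale (ltW a0) h1.
- exact: soc_scale (ltW a0) h2.
- by rewrite dotvZl dotvZr h3 !mulr0.
Qed.

(** Near [z] the first half stays in the interior of the cone, so the set consists of the pairs with
    [y = 0]: locally a linear subspace. *)
Lemma stable_compl_soc_interior z :
  Om z -> enorm (tl (lsubmx z)) < lsubmx z 0 0 -> dir_normal_stable Om z.
Proof.
move=> [zx zy zxy] hx.
have intr : \forall u \near z, enorm (tl (lsubmx u)) < lsubmx u 0 0.
  have lc : lsubmx @ z --> lsubmx z.
    by apply: differentiable_continuous; exact: differentiable_lsubmx.
  have c1 : (fun u : 'rV[R]_(k.+1 + k.+1) => lsubmx u 0 0 - enorm (tl (lsubmx u))) @ z -->
      lsubmx z 0 0 - enorm (tl (lsubmx z)).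
    apply: (@cvgB _ _ _ (nbhs z)).
      by move/(@cvg_mxP _ _ (nbhs z)) : lc; exact.
    by apply: (@cvg_enorm _ _ _ (nbhs z)); exact: (@tl_cvg _ _ _ (nbhs z)).
  have : \forall u \near z, 0 < lsubmx u 0 0 - enorm (tl (lsubmx u)).
    by apply: (@cvgr_gt _ _ (nbhs z) _ _ _ c1); rewrite subr_gt0.
  by apply: filterS => u; rewrite subr_gt0.
move/nbhs_ballP : intr => [delta /= delta0 hdelta].
have int e : `|e| < delta -> enorm (tl (lsubmx (z + e))) < lsubmx (z + e) 0 0.
  move=> he; apply: hdelta.
  by rewrite -ball_normE /= opprD addrA subrr add0r normrN.
have y0 := soc_interior_orthogonal hx zy zxy.
apply: (@conic_dir_normal_stable _ _ _ delta) => // e a a0 he hae [ex ey exy].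
have := soc_interior_orthogonal (int e he) ey exy.
rewrite linearD /= y0 add0r => ey0.
have ay : rsubmx (z + a *: e) = 0 by rewrite linearD linearZ /= y0 ey0 scaler0 addr0.
split; rewrite ?ay.
- by rewrite socE ltW// int.
- by rewrite socE /tl mxE scale0r subr0 enorm0.
- by rewrite dotvC dotv0l.
Qed.

(** The image [Z] of [z] in the chart has [X_1 = 0] and [Y_2 = 0]. Near [Z] the set is given by
    [X_1 = Y_2 = 0] if [Y_1 > 0] at [Z], and by [Y_2 = 0] with [X_1], [Y_1] nonnegative and
    complementary if [Y_1 = 0] there. Both are cones with apex [Z]. *)
Lemma stable_compl_soc_boundary z :
  Om z -> enorm (tl (lsubmx z)) = lsubmx z 0 0 -> tl (lsubmx z) != 0 ->
  dir_normal_stable Om z.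
Proof.
move=> Oz hx tx.
set Z := soc_chart (-1) z.
have tZ : tl (lsubmx Z) != 0 by rewrite tl_lsubmx_chart.
have K1 : cancel (@soc_chart R k (-1)) (soc_chart 1).
  by move=> u; rewrite -[in soc_chart 1](opprK 1) chartK.
have : Om (soc_chart 1 Z) by rewrite K1.
move/(compl_soc_chart tZ) => [_ Y0 _ tY].
have X0 : lsubmx Z 0 0 = 0 by rewrite lsubmx_chart00 hx mulN1r subrr.
have [j tj] : exists j, tl (lsubmx Z) 0 j != 0.
  apply: contrapT => nj; move/eqP : tZ; apply; apply/rowP => j; rewrite [RHS]mxE.
  by apply/eqP; apply: contrapT => /negP ?; apply: nj; exists j.
have j0 : j != 0 by apply: contraNneq tj => ->; rewrite tl00.
(* Within this radius the nonzero tail entry [j] cannot vanish, so the chart description stays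
   valid, and [Y_1] stays positive if it is positive at [Z]. *)
have [delta [delta0 dj dY]] : exists delta : R, [/\ 0 < delta,
    delta <= `|tl (lsubmx Z) 0 j| & 0 < rsubmx Z 0 0 -> delta <= rsubmx Z 0 0].
  have [Yp|Yn] := ltP 0 (rsubmx Z 0 0).
    exists (Num.min `|tl (lsubmx Z) 0 j| (rsubmx Z 0 0)).
    by split; rewrite ?lt_min ?normr_gt0 ?tj ?ge_min ?lexx ?orbT.
  by exists `|tl (lsubmx Z) 0 j|; split; rewrite ?normr_gt0 ?lexx// ltNge Yn.
have nz (e : 'rV[R]_(k.+1 + k.+1)) : `|e| < delta -> tl (lsubmx (Z + e)) != 0.
  move=> he; apply/eqP => /rowP/(_ j).
  rewrite linearD /= tlD mxE [in RHS]mxE => /eqP; rewrite addr_eq0 => /eqP ej.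
  move: dj; rewrite ej normrN tlS// leNgt => /negP; apply.
  by apply: le_lt_trans he; rewrite mxE norm_coord.
have dYe (e : 'rV[R]_(k.+1 + k.+1)) : `|e| < delta -> 0 < rsubmx Z 0 0 ->
    0 < rsubmx Z 0 0 + rsubmx e 0 0.
  move=> he /dY hd; have : `|rsubmx e 0 0| < rsubmx Z 0 0.
    by apply: lt_le_trans hd; apply: le_lt_trans he; rewrite mxE norm_coord.
  by rewrite ltr_norml; lra.
apply: (conic_chart_dir_normal_stable (C1_at_chart (-1) tx) (C1_at_chart 1 tZ)
  K1 (chartK 1) delta0).
have L (b : R) u : lsubmx (Z + b *: u) 0 0 = b * lsubmx u 0 0.
  by rewrite linearD linearZ /= mxE X0 add0r mxE.
have r (b : R) u : rsubmx (Z + b *: u) 0 0 = rsubmx Z 0 0 + b * rsubmx u 0 0.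
  by rewrite linearD linearZ /= mxE [X in _ + X]mxE.
have T (b : R) u : tl (rsubmx (Z + b *: u)) = b *: tl (rsubmx u).
  by rewrite linearD linearZ /= tlD tlZ tY add0r.
move=> e a a0 he hae; rewrite -/Z -[in soc_chart 1 (Z + e)](scale1r e).
move/(compl_soc_chart (nz (1 *: e) _)); rewrite scale1r => /(_ he).
rewrite -[in Z + e](scale1r e) !L !r !T !mul1r scale1r => -[X1 Y1 XY1 T1].
apply/(compl_soc_chart (nz _ hae)); rewrite L r T T1 scaler0.
have Ye := dYe _ he; have Yae := dYe _ hae.
have [Yp|Yn] := ltP 0 (rsubmx Z 0 0).
  have ex : lsubmx e 0 0 = 0.
    by move/eqP: XY1; rewrite mulf_eq0 => /orP[/eqP//|/eqP]; have := Ye Yp; lra.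
  rewrite ex mulr0 mul0r; split => //; apply: ltW; have := Yae Yp.
  by rewrite linearZ /= [X in _ + X]mxE.
have Y00 : rsubmx Z 0 0 = 0 by apply/le_anti; rewrite Yn.
move: X1 Y1 XY1; rewrite Y00 !add0r => X1 Y1 XY1.
by split; rewrite ?mulr_ge0 ?(ltW a0)// mulrACA XY1 mulr0.
Qed.

(** If the first half is nonzero it is interior or on the boundary with nonzero tail; if only the
    second half is nonzero, the swap [S] reduces to that case; otherwise [z] is the origin. *)
Lemma stable_compl_soc z : Om z -> dir_normal_stable Om z.
Proof.
pose S : 'M[R]_(k.+1 + k.+1) := block_mx 0 1%:M 1%:M 0.
have SE u : u *m S = row_mx (rsubmx u) (lsubmx u).
  by rewrite -{1}(hsubmxK u) mul_row_block !(mulmx0, mulmx1) add0r addr0.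
have St : S^T = S by rewrite /S tr_block_mx !trmx0 !trmx1.
have SS : S *m S = 1%:M.
  by rewrite mulmx_block !(mulmx0, mul0mx, mulmx1) !(addr0, add0r) -scalar_mx_block.
have OS u : Om u -> Om (u *m S).
  by move=> [h1 h2 h3]; rewrite SE; split; rewrite ?row_mxKl ?row_mxKr// dotvC.
have half u : Om u -> lsubmx u != 0 -> dir_normal_stable Om u.
  move=> Ou u0; have [hx _ _] := Ou.
  move: hx; rewrite socE le_eqVlt => /orP[/eqP hx|]; last exact: stable_compl_soc_interior.
  apply: stable_compl_soc_boundary => //; apply: contraNneq u0 => t0.
  by apply/eqP/tl_eq0 => //; rewrite -hx t0 enorm0.
move=> Oz; have [x0|] := eqVneq (lsubmx z) 0; last exact: half.
have [y0|y0] := eqVneq (rsubmx z) 0.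
  have -> : z = 0 by rewrite -(hsubmxK z) x0 y0 row_mx0.
  exact: stable_compl_soc_origin.
apply: (@dir_normal_stable_iso _ _ S); rewrite ?St//.
by apply: half; [exact: OS|rewrite SE row_mxKl].
Qed.

End Stability.

(** * Products of sets *)

Section Products.
Context {R : realType}.

Lemma dotv_sumr (I : finType) p (v : 'rV[R]_p) (h : I -> 'rV[R]_p) :
  dotv v (\sum_i h i) = \sum_i dotv v (h i).
Proof.
by rewrite dotvE linear_sum mulmx_sumr summxE; under eq_bigr do rewrite -dotvE.
Qed.

Lemma enorm_sum (I : finType) p (h : I -> 'rV[R]_p) :
  enorm (\sum_i h i) <= \sum_i enorm (h i).
Proof.
elim/big_ind2 : _ => [|x a y b xa yb|//]; first by rewrite enorm0.
exact: le_trans (enormD _ _) (lerD xa yb).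
Qed.

Lemma enorm_mulmxr_iso p q (A : 'M[R]_(p, q)) h : A *m A^T = 1%:M ->
  enorm (h *m A) = enorm h.
Proof. by move=> AA; rewrite /enorm !dotvE trmx_mul mulmxA -(mulmxA h) AA mulmx1. Qed.

(* The matrices [A i] are the projections on the blocks of an orthogonal
   decomposition, and [D] is the corresponding product of the sets [C i]. *)
Context {q : nat} {I : finType} {p : I -> nat} {A : forall i, 'M[R]_(q, p i)}.
Hypothesis AA : forall i, (A i)^T *m A i = 1%:M.
Hypothesis A0 : forall i j, i != j -> (A i)^T *m A j = 0.
Hypothesis A1 : \sum_i A i *m (A i)^T = 1%:M.
Context {C : forall i, set 'rV[R]_(p i)} {D : set 'rV[R]_q}.
Arguments C i : clear implicits.
Hypothesis DC : forall u, D u <-> forall i : I, C i (u *m A i).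

Lemma block_sum (u : 'rV[R]_q) : \sum_i u *m A i *m (A i)^T = u.
Proof.
rewrite -[RHS]mulmx1 -A1 mulmx_sumr.
by apply: eq_bigr => i _; rewrite mulmxA.
Qed.

Lemma dotv_block x y : dotv x y = \sum_i dotv (x *m A i) (y *m A i).
Proof.
rewrite -{1}(block_sum y) dotv_sumr; apply: eq_bigr => i _.
by rewrite -dotv_mulmxr trmxK.
Qed.

Lemma enorm_block x i : enorm (x *m A i) <= enorm x.
Proof.
rewrite ler_sqrt ?dotv_ge0// [leRHS]dotv_block (bigD1 i)//= lerDl.
by apply: sumr_ge0 => j _; exact: dotv_ge0.
Qed.

Lemma dir_normal_block z d v i : dir_normal_cone D z d v ->
  dir_normal_cone (C i) (z *m A i) (d *m A i) (v *m A i).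
Proof.
apply: dir_normal_proj => [//|y /DC//|u c /DC Du Cc]; apply/DC => j.
rewrite mulmxDl -mulmxA; have [<-|ij] := eqVneq i j.
  by rewrite AA mulmx1 addrC subrK.
by rewrite A0// mulmx0 addr0.
Qed.

Lemma regular_normal_prod u v :
  (forall i, regular_normal_cone (C i) (u *m A i) (v *m A i)) ->
  regular_normal_cone D u v.
Proof.
move=> N; split=> [|e e0]; first by apply: (DC u).2 => i; case: (N i).
(* An equal share of [e] for each block; the successor covers an empty index set. *)
have e1 : 0 < e / #|I|.+1%:R by rewrite divr_gt0.
have : \forall z \near u, forall i, C i (z *m A i) ->
    dotv (v *m A i) (z *m A i - u *m A i) <=
    e / #|I|.+1%:R * enorm (z *m A i - u *m A i).
  apply: (@filter_forall _ _ _ (nbhs u)) => i.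
  have [_ /(_ _ e1) h] := N i.
  exact: (@continuous_mulmxr R 1 q (p i) (A i) u _ h).
apply: filterS => z hz /DC Dz.
rewrite dotv_block.
apply: (@le_trans _ _ (\sum_(i : I) e / #|I|.+1%:R * enorm (z - u))).
  apply: ler_sum => i _; rewrite mulmxBl; apply: le_trans (hz i (Dz i)) _.
  by rewrite -mulmxBl ler_wpM2l ?(ltW e1)// enorm_block.
rewrite sumr_const -[leLHS]mulr_natl mulrA ler_wpM2r ?enorm_ge0// mulrCA.
by rewrite ler_piMr ?(ltW e0)// ler_pdivrMr// mul1r ler_nat.
Qed.

(** Stability provides sequences in all factors for the common steps [1 / (k + 1)], and these can be
    added up. *)
Lemma dir_normal_prod z d v :
  (forall i, dir_normal_stable (C i) (z *m A i)) ->
  (forall i, dir_normal_cone (C i) (z *m A i) (d *m A i) (v *m A i)) ->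
  dir_normal_cone D z d v.
Proof.
move=> st N; pose t k : R := k.+1%:R^-1.
have t0 k : 0 < t k by rewrite invr_gt0.
have tc : t @ \oo --> (0 : R) by exact: cvg_harmonic.
(* The sequences of factor [i] are embedded by [(A i)^T], with zero components in the other blocks,
   so that their sum restricts to the right sequence in each block. *)
have h i : exists dv : (nat -> 'rV[R]_q) * (nat -> 'rV[R]_q),
    [/\ dv.1 @ \oo --> d *m A i *m (A i)^T, dv.2 @ \oo --> v *m A i *m (A i)^T,
     (forall k j, i != j -> dv.1 k *m A j = 0 /\ dv.2 k *m A j = 0) &
     \forall k \near \oo, regular_normal_cone (C i)
       (z *m A i + t k *: (dv.1 k *m A i)) (dv.2 k *m A i)].
  have [d' [v' [dc vc N']]] := st i _ _ (N i) t t0 tc.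
  exists (fun k => d' k *m (A i)^T, fun k => v' k *m (A i)^T); split => /=.
  - by apply: cvg_mulmx => //; exact: cvg_cst.
  - by apply: cvg_mulmx => //; exact: cvg_cst.
  - by move=> k j ij; rewrite -!mulmxA A0// !mulmx0.
  - by apply: filterS N' => k; rewrite -!mulmxA AA !mulmx1.
have {h} [dv hdv] := choice h.
pose d_ k := \sum_i (dv i).1 k; pose v_ k := \sum_i (dv i).2 k.
have dE k i : d_ k *m A i = (dv i).1 k *m A i.
  rewrite mulmx_suml (bigD1 i)//= big1 ?addr0// => j ji.
  by have [_ _ /(_ k i ji)[]] := hdv j.
have vE k i : v_ k *m A i = (dv i).2 k *m A i.
  rewrite mulmx_suml (bigD1 i)//= big1 ?addr0// => j ji.
  by have [_ _ /(_ k i ji)[]] := hdv j.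
have : \forall k \near \oo, forall i, regular_normal_cone (C i)
       (z *m A i + t k *: ((dv i).1 k *m A i)) ((dv i).2 k *m A i).
  by apply: filter_forall => i; case: (hdv i).
(* Stability holds only eventually, while a directional normal asks for all indices: the sequences
   are shifted by [M]. *)
move=> [M _ hM].
have shift (T : topologicalType) (f : nat -> T) (l : T) :
    f @ \oo --> l -> (fun k => f (k + M)%N) @ \oo --> l.
  by move=> fl; apply: (@cvg_subsequence _ f l (addn^~ M)) => // k; exact: leq_addr.
exists (fun k => t (k + M)%N), (fun k => d_ (k + M)%N), (fun k => v_ (k + M)%N).
split => //; first exact: shift.
- apply: shift; rewrite -(block_sum d); apply/cvg_mxP => i j.
  rewrite summxE; under eq_fun do rewrite summxE.
  by apply: cvg_sumr => l; have [/cvg_mxP + _ _ _] := hdv l; exact.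
- apply: shift; rewrite -(block_sum v); apply/cvg_mxP => i j.
  rewrite summxE; under eq_fun do rewrite summxE.
  by apply: cvg_sumr => l; have [_ /cvg_mxP + _ _] := hdv l; exact.
move=> k; apply: regular_normal_prod => i.
rewrite mulmxDl -scalemxAl dE vE; apply: hM => /=.
exact: leq_addl.
Qed.

(** Nearest points in the factors are assembled into one point of [D], and the triangle inequality
    is applied to the block components of the difference. *)
Lemma edistance_prod x : (forall i, closed (C i)) -> (forall i, C i !=set0) ->
  edistance D x <= \sum_i edistance (C i) (x *m A i).
Proof.
move=> Ccl Cn0.
have h i : exists Y : 'rV[R]_q, [/\ C i (Y *m A i),
    forall j, i != j -> Y *m A j = 0 &
    edistance (C i) (x *m A i) = enorm (x *m A i *m (A i)^T - Y)].
  have [y [Cy -> _]] := projection (x *m A i) (Ccl i) (Cn0 i).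
  exists (y *m (A i)^T); split; first by rewrite -mulmxA AA mulmx1.
    by move=> j ij; rewrite -mulmxA A0// mulmx0.
  by rewrite -mulmxBl enorm_mulmxr_iso// trmxK.
have {h} [Y hY] := choice h.
have DY : D (\sum_i Y i).
  apply/DC => i; rewrite mulmx_suml (bigD1 i)//= big1 ?addr0//.
    by case: (hY i).
  by move=> j ji; have [_ /(_ i ji)] := hY j.
apply: le_trans (edistance_le x DY) _.
rewrite -{1}(block_sum x) -sumrB; apply: le_trans (enorm_sum _) _.
by apply: ler_sum => i _; have [_ _ ->] := hY i.
Qed.

End Products.

(** * Orthogonal block decompositions of R^m and of R^m x R^m *)

Lemma sum_block_diag_mx (R : realType) (I : finType) q (X : I -> 'M[R]_q) :
  \sum_i block_mx (X i) 0 0 (X i) = block_mx (\sum_i X i) 0 0 (\sum_i X i).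
Proof.
elim/big_rec2 : _ => [|i X1 Y _ ->]; first by rewrite block_mx_const.
by rewrite add_block_mx !addr0.
Qed.

Section Blocks.
Context {R : realType} {J : nat} {k : 'I_J -> nat}.
Local Notation m := (\sum_(i < J) (k i).+1)%N.

Definition block_proj (i : 'I_J) : 'M[R]_(m, (k i).+1) := submxrow 1%:M i.

Definition pair_proj (i : 'I_J) : 'M[R]_(m + m, (k i).+1 + (k i).+1) :=
  block_mx (block_proj i) 0 0 (block_proj i).

Lemma mul_block_proj n (A : 'M[R]_(n, m)) i : A *m block_proj i = submxrow A i.
Proof. by rewrite mul_submxrow mulmx1. Qed.

Lemma block_proj_tr i j :
  (block_proj i)^T *m block_proj j = submxblock (1%:M : 'M[R]_m) i j.
Proof. by rewrite mul_block_proj tr_submxrow trmx1 -submxblockEv. Qed.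

Lemma block_projK i : (block_proj i)^T *m block_proj i = 1%:M.
Proof. by rewrite block_proj_tr -mxdiagZ submxblock_diag. Qed.

Lemma block_proj_ortho i j : i != j -> (block_proj i)^T *m block_proj j = 0.
Proof. by move=> ij; rewrite block_proj_tr -mxdiagZ mxblockK (negPf ij). Qed.

Lemma block_proj_sum : \sum_i block_proj i *m (block_proj i)^T = 1%:M.
Proof.
transitivity (\mxrow_i block_proj i *m \mxcol_i submxcol (1%:M : 'M[R]_m) i).
  by rewrite mul_mxrow_mxcol; apply: eq_bigr => i _; rewrite tr_submxrow trmx1.
by rewrite submxrowK submxcolK mulmx1.
Qed.

Lemma mul_pair_proj n (A B : 'M[R]_(n, m)) i :
  row_mx A B *m pair_proj i = row_mx (submxrow A i) (submxrow B i).
Proof. by rewrite mul_row_block !mulmx0 add0r addr0 !mul_block_proj. Qed.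

Lemma pair_projK i : (pair_proj i)^T *m pair_proj i = 1%:M.
Proof.
rewrite tr_block_mx !trmx0 mulmx_block !(mulmx0, mul0mx, addr0, add0r).
by rewrite block_projK -scalar_mx_block.
Qed.

Lemma pair_proj_ortho i j : i != j -> (pair_proj i)^T *m pair_proj j = 0.
Proof.
move=> ij; rewrite tr_block_mx !trmx0 mulmx_block !(mulmx0, mul0mx, addr0, add0r).
by rewrite block_proj_ortho// block_mx_const.
Qed.

Lemma pair_proj_sum : \sum_i pair_proj i *m (pair_proj i)^T = 1%:M.
Proof.
rewrite [RHS](scalar_mx_block m m) -block_proj_sum.
rewrite -sum_block_diag_mx; apply: eq_bigr => i _.
by rewrite tr_block_mx !trmx0 mulmx_block !(mulmx0, mul0mx, addr0, add0r).
Qed.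

(** The inner product of [x] and [y] is the sum over the blocks, all of whose terms are nonnegative
    on the cones; it vanishes exactly when each term does. *)
Lemma Omega_pair (u : 'rV[R]_(m + m)) :
  Omega u <-> forall i : 'I_J, (compl_set soc : set 'rV[R]__) (u *m pair_proj i).
Proof.
rewrite -[u]hsubmxK; set x := lsubmx u; set y := rsubmx u.
have dE : dotv x y = \sum_i dotv (submxrow x i) (submxrow y i).
  rewrite (dotv_block block_proj_sum).
  by apply: eq_bigr => i _; rewrite !mul_block_proj.
split=> [[Kx Ky xy] i|h].
  rewrite mul_pair_proj; rewrite row_mxKl row_mxKr in Kx Ky xy *.
  split; rewrite ?row_mxKl ?row_mxKr; [exact: Kx|exact: Ky|].
  move/eqP : xy; rewrite dE psumr_eq0 => [/allP/(_ i (mem_index_enum i))/eqP//|j _].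
  exact: soc_dotv_ge0.
split; rewrite ?row_mxKl ?row_mxKr.
- by move=> i; have [] := h i; rewrite mul_pair_proj row_mxKl.
- by move=> i; have [] := h i; rewrite mul_pair_proj row_mxKr.
rewrite dE big1// => i _.
by have [] := h i; rewrite mul_pair_proj row_mxKl row_mxKr.
Qed.

Lemma closed_Omega : closed (@Omega R J k).
Proof.
apply: closed_compl_set.
have -> : @soc_prod R J k =
    \bigcap_(i in [set: 'I_J]) ((fun x => x *m block_proj i) @^-1` soc).
  apply/seteqP; split=> x /=.
    by move=> h i _ /=; rewrite mul_block_proj; exact: h.
  by move=> h i; rewrite -mul_block_proj; exact: (h i I).
apply: closed_bigI => i _; apply: preimage_closed; last exact: closed_soc.
by move=> x _; exact: continuous_mulmxr.
Qed.

End Blocks.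

(** * Pairs of maps and products of two sets *)

Section RowMx.
Context {R : realType} {n p q : nat}.
Implicit Types (f : 'rV[R]_n -> 'rV[R]_p) (g : 'rV[R]_n -> 'rV[R]_q).

Lemma differentiable_row_mx f g z : differentiable f z -> differentiable g z ->
  differentiable (fun y => row_mx (f y) (g y)) z.
Proof.
move=> df dg.
have -> : (fun y => row_mx (f y) (g y)) =
    (fun y => f y *m row_mx 1%:M 0) + (fun y => g y *m row_mx 0 1%:M).
  apply/funext => y; rewrite !fctE /= !mul_mx_row !(mulmx0, mulmx1).
  by rewrite add_row_mx addr0 add0r.
by apply: differentiableD; exact: differentiable_mulmxr.
Qed.

(** Composition with the two constant projections shows that the column blocks of the Jacobian are
    those of [f] and [g]. *)
Lemma jacobian_row_mx f g z : differentiable f z -> differentiable g z ->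
  'J (fun y => row_mx (f y) (g y)) z = row_mx ('J f z) ('J g z).
Proof.
move=> df dg; have dfg := differentiable_row_mx df dg.
have Jl := jacobian_mulmxr (col_mx 1%:M (0 : 'M[R]_(q, p))) dfg.
have Jr := jacobian_mulmxr (col_mx (0 : 'M[R]_(p, q)) 1%:M) dfg.
have fE : (fun y => row_mx (f y) (g y) *m col_mx 1%:M 0) = f.
  by apply/funext => y; rewrite mul_row_col mulmx1 mulmx0 addr0.
have gE : (fun y => row_mx (f y) (g y) *m col_mx 0 1%:M) = g.
  by apply/funext => y; rewrite mul_row_col mulmx1 mulmx0 add0r.
rewrite fE in Jl; rewrite gE in Jr; rewrite Jl Jr.
set M := 'J _ z; rewrite -mul_mx_row -[LHS]mulmx1; congr (_ *m _).
by rewrite (scalar_mx_block p q 1) block_mxEh.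
Qed.

Lemma C1_row_mx f g : C1 f -> C1 g -> C1 (fun y => row_mx (f y) (g y)).
Proof.
move=> [df cf] [dg cg]; split=> [z|]; first exact: differentiable_row_mx.
have -> : (fun z => 'J (fun y => row_mx (f y) (g y)) z) =
    fun z => row_mx ('J f z) ('J g z).
  by apply/funext => z; exact: jacobian_row_mx.
by move=> z; apply: (@cvg_row_mx _ _ (nbhs z)); [exact: cf|exact: cg].
Qed.

Lemma enorm_row_mx (x : 'rV[R]_p) (y : 'rV[R]_q) :
  enorm (row_mx x y) <= enorm x + enorm y.
Proof.
have -> : row_mx x y = row_mx x 0 + row_mx 0 y by rewrite add_row_mx addr0 add0r.
apply: le_trans (enormD _ _) _.
rewrite /enorm !dotvE !tr_row_mx !mul_row_col !(trmx0, mulmx0, mul0mx, addr0, add0r).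
by [].
Qed.

Lemma edistance_row_mx (C : set 'rV[R]_p) (D : set 'rV[R]_q) x y :
  closed C -> closed D -> C !=set0 -> D !=set0 ->
  edistance [set u | C (lsubmx u) /\ D (rsubmx u)] (row_mx x y) <=
  edistance C x + edistance D y.
Proof.
move=> Ccl Dcl C0 D0.
have [a [Ca -> _]] := projection x Ccl C0.
have [b [Db -> _]] := projection y Dcl D0.
apply: le_trans (enorm_row_mx _ _).
rewrite -add_row_mx -opp_row_mx; apply: edistance_le.
by rewrite /= row_mxKl row_mxKr.
Qed.

Lemma dir_normal_row_mx (C : set 'rV[R]_p) (D : set 'rV[R]_q) x y a b v w :
  dir_normal_cone [set u | C (lsubmx u) /\ D (rsubmx u)]
    (row_mx x y) (row_mx a b) (row_mx v w) ->
  dir_normal_cone C x a v /\ dir_normal_cone D y b w.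
Proof.
have El (u : 'rV[R]_(p + q)) : u *m col_mx 1%:M 0 = lsubmx u.
  by rewrite -[in LHS](hsubmxK u) mul_row_col mulmx1 mulmx0 addr0.
have Er (u : 'rV[R]_(p + q)) : u *m col_mx 0 1%:M = rsubmx u.
  by rewrite -[in LHS](hsubmxK u) mul_row_col mulmx1 mulmx0 add0r.
move=> N; split.
- rewrite -[x](row_mxKl x y) -[a](row_mxKl a b) -[v](row_mxKl v w) -!El.
  apply: dir_normal_proj N; rewrite ?tr_col_mx.
  + by rewrite mul_row_col trmx1 trmx0 mulmx1 mulmx0 addr0.
  + by move=> u [Cu _]; rewrite El.
  + move=> u c [Cu Du] Cc; rewrite El trmx1 trmx0 mul_mx_row mulmx1 mulmx0.
    by split; rewrite linearD /= ?row_mxKl ?row_mxKr ?addr0// addrC subrK.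
- rewrite -[y](row_mxKr x y) -[b](row_mxKr a b) -[w](row_mxKr v w) -!Er.
  apply: dir_normal_proj N; rewrite ?tr_col_mx.
  + by rewrite mul_row_col trmx1 trmx0 mulmx1 mulmx0 add0r.
  + by move=> u [_ Du]; rewrite Er.
  + move=> u c [Cu Du] Dc; rewrite Er trmx1 trmx0 mul_mx_row mulmx1 mulmx0.
    by split; rewrite linearD /= ?row_mxKl ?row_mxKr ?addr0// addrC subrK.
Qed.

Lemma tangent_row_mx (C : set 'rV[R]_p) (D : set 'rV[R]_q) x y a b :
  tangent_cone [set u | C (lsubmx u) /\ D (rsubmx u)] (row_mx x y) (row_mx a b) ->
  tangent_cone C x a /\ tangent_cone D y b.
Proof.
move=> /tangent_dir_normal0; rewrite -row_mx0 => /dir_normal_row_mx[TC TD].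
by split; apply/tangent_dir_normal0.
Qed.

End RowMx.

(** * Tangents, normals and distances for [Omega] and its factors *)

Section OmegaCones.
Context {R : realType} {J : nat} {k : 'I_J -> nat}.
Local Notation m := (\sum_(i < J) (k i).+1)%N.
Local Notation OmB := (fun i : 'I_J => @compl_set R (k i).+1 soc).
Implicit Types x y a b v w : 'rV[R]_m.

Lemma dir_normal_Omega_block x y a b v w i :
  dir_normal_cone (@Omega R J k) (row_mx x y) (row_mx a b) (row_mx v w) ->
  dir_normal_cone (OmB i) (row_mx (submxrow x i) (submxrow y i))
    (row_mx (submxrow a i) (submxrow b i)) (row_mx (submxrow v i) (submxrow w i)).
Proof.
move/(dir_normal_block (@pair_projK R J k) (@pair_proj_ortho R J k)
  (C := OmB) (@Omega_pair R J k) i).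
by rewrite 3!mul_pair_proj.
Qed.

Lemma tangent_Omega_block x y a b i :
  tangent_cone (@Omega R J k) (row_mx x y) (row_mx a b) ->
  tangent_cone (OmB i) (row_mx (submxrow x i) (submxrow y i))
    (row_mx (submxrow a i) (submxrow b i)).
Proof.
move=> /tangent_dir_normal0 N; apply/tangent_dir_normal0.
move: N; rewrite -row_mx0 => /(@dir_normal_Omega_block _ _ _ _ _ _ i).
by rewrite !submxrow0 row_mx0.
Qed.

(** This is the inclusion that needs a common step size, supplied by the stability of each factor at
    its base point. *)
Lemma dir_normal_Omega x y a b v w : Omega (row_mx x y) ->
  (forall i, dir_normal_cone (OmB i) (row_mx (submxrow x i) (submxrow y i))
    (row_mx (submxrow a i) (submxrow b i)) (row_mx (submxrow v i) (submxrow w i))) ->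
  dir_normal_cone (@Omega R J k) (row_mx x y) (row_mx a b) (row_mx v w).
Proof.
move=> Oxy N.
apply: (dir_normal_prod (@pair_projK R J k) (@pair_proj_ortho R J k)
    (@pair_proj_sum R J k) (C := OmB) (@Omega_pair R J k)) => i.
  by apply: stable_compl_soc; exact: (Omega_pair _).1.
by rewrite 3!mul_pair_proj.
Qed.

Lemma tangent_Omega x y a b : Omega (row_mx x y) ->
  (forall i, tangent_cone (OmB i) (row_mx (submxrow x i) (submxrow y i))
    (row_mx (submxrow a i) (submxrow b i))) ->
  tangent_cone (@Omega R J k) (row_mx x y) (row_mx a b).
Proof.
move=> Oxy T; apply/tangent_dir_normal0; rewrite -row_mx0.
apply: dir_normal_Omega => // i; rewrite !submxrow0 row_mx0.
exact/tangent_dir_normal0.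
Qed.

Lemma edistance_Omega x y :
  edistance (@Omega R J k) (row_mx x y) <=
  \sum_(i < J) edistance (OmB i) (row_mx (submxrow x i) (submxrow y i)).
Proof.
have cl i : closed (OmB i) by apply: closed_compl_set; exact: closed_soc.
have ne i : OmB i !=set0.
  exists 0; split; rewrite ?linear0 ?dotv0l// socE.
    by rewrite /tl !mxE scale0r subr0 enorm0.
  by rewrite /tl !mxE scale0r subr0 enorm0.
apply: le_trans (edistance_prod (@pair_projK R J k) (@pair_proj_ortho R J k)
  (@pair_proj_sum R J k) (C := OmB) (@Omega_pair R J k) (row_mx x y) cl ne) _.
by apply: ler_sum => i _; rewrite mul_pair_proj.
Qed.

End OmegaCones.

(** * Equivalence of the blockwise and the global condition *)

Section Equivalence.
Context {R : realType} {n l J : nat} {k : 'I_J -> nat}.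
Local Notation m := (\sum_(i < J) (k i).+1)%N.
Context {Lambda : set 'rV[R]_l} {F : 'rV[R]_n -> 'rV[R]_l}.
Context {G H : 'rV[R]_n -> 'rV[R]_m} {zs : 'rV[R]_n}.
Hypotheses (dG : differentiable G zs) (dH : differentiable H zs).

Lemma blockE (f : 'rV[R]_n -> 'rV[R]_m) i :
  block f i = fun z => f z *m block_proj i.
Proof. by apply/funext => z; rewrite mul_block_proj. Qed.

Lemma mul_jacobian_block (f : 'rV[R]_n -> 'rV[R]_m) (w : 'rV[R]_n) i :
  differentiable f zs -> w *m 'J (block f i) zs = submxrow (w *m 'J f zs) i.
Proof. by move=> df; rewrite blockE jacobian_mulmxr// mulmxA mul_block_proj. Qed.

Lemma adjoint_block_sum (f : 'rV[R]_n -> 'rV[R]_m) (lam : 'rV[R]_m) :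
  differentiable f zs ->
  \sum_(i < J) submxrow lam i *m ('J (block f i) zs)^T = lam *m ('J f zs)^T.
Proof.
move=> df; rewrite -[in RHS](block_sum block_proj_sum lam) mulmx_suml.
apply: eq_bigr => i _.
by rewrite blockE jacobian_mulmxr// trmx_mul mul_block_proj mulmxA.
Qed.

Lemma adjoint_equation (lG lH : 'rV[R]_m) :
  \sum_(i < J) (submxrow lG i *m ('J (block G i) zs)^T +
                submxrow lH i *m ('J (block H i) zs)^T) =
  lG *m ('J G zs)^T + lH *m ('J H zs)^T.
Proof.
by rewrite -(adjoint_block_sum lG dG) -(adjoint_block_sum lH dH); exact: big_split.
Qed.

Lemma row_mul_jacobian_block (w : 'rV[R]_n) i :
  row_mx (w *m 'J (block G i) zs) (w *m 'J (block H i) zs) =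
  row_mx (submxrow (w *m 'J G zs) i) (submxrow (w *m 'J H zs) i).
Proof.
exact: (congr2 (@row_mx R 1 _ _) (mul_jacobian_block w i dG) (mul_jacobian_block w i dH)).
Qed.

Lemma conditionA_B : conditionA Lambda F G H zs -> conditionB Lambda F G H zs.
Proof.
move=> cA w w0 TL TO lF lG lH eq0 NL NO.
apply: (cA w w0 TL _ lF lG lH _ NL) => [i||i].
- apply: (eq_ind_r (tangent_cone _ _) _ (row_mul_jacobian_block w i)).
  exact: tangent_Omega_block TO.
- by rewrite adjoint_equation addrA.
- apply: (eq_ind_r (fun d => dir_normal_cone _ _ d _) _ (row_mul_jacobian_block w i)).
  exact: dir_normal_Omega_block NO.
Qed.

Lemma conditionB_A : Omega (row_mx (G zs) (H zs)) ->
  conditionB Lambda F G H zs -> conditionA Lambda F G H zs.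
Proof.
move=> OGH cB w w0 TL TO lF lG lH eq0 NL NO.
apply: (cB w w0 TL _ lF lG lH _ NL).
- apply: (tangent_Omega OGH) => i.
  exact: (eq_ind _ (tangent_cone _ _) (TO i) _ (row_mul_jacobian_block w i)).
- by rewrite -addrA -adjoint_equation.
- apply: (dir_normal_Omega OGH) => i.
  exact: (eq_ind _ (fun d => dir_normal_cone _ _ d _) (NO i) _ (row_mul_jacobian_block w i)).
Qed.

End Equivalence.

(** * The system as a single constraint with values in the product of [Lambda] and [Omega] *)

Theorem theorem7p2 (R : realType) (n l J : nat) (k : 'I_J -> nat)
    (Lambda : set 'rV[R]_l) (F : 'rV[R]_n -> 'rV[R]_l)
    (G H : 'rV[R]_n -> 'rV[R]_(\sum_(i < J) (k i).+1)) (zs : 'rV[R]_n) :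
  closed Lambda -> C1 F -> C1 G -> C1 H ->
  feasible Lambda F G H zs ->
  (conditionA Lambda F G H zs <-> conditionB Lambda F G H zs) /\
  (conditionA Lambda F G H zs -> local_error_bound Lambda F G H zs).
Proof.
move=> Lcl CF CG CH [KG KH GH LF].
have [dF _] := CF; have [dG _] := CG; have [dH _] := CH.
have OE z : Omega (row_mx (G z) (H z)) <->
    [/\ soc_prod (G z), soc_prod (H z) & dotv (G z) (H z) = 0].
  by rewrite /Omega /compl_set /= row_mxKl row_mxKr.
have OGH : Omega (row_mx (G zs) (H zs)) by exact/OE.
have AB := @conditionA_B R n l J k Lambda F G H zs (dG zs) (dH zs).
split.
  by split=> //; exact: conditionB_A.
move=> /AB cB.
pose GH' z := row_mx (G z) (H z).
pose P z := row_mx (F z) (GH' z).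
have CGH : C1 GH' by exact: C1_row_mx.
have CP : C1 P by exact: C1_row_mx.
have JP : 'J P zs = row_mx ('J F zs) (row_mx ('J G zs) ('J H zs)).
  rewrite jacobian_row_mx//; last by case: CGH.
  by rewrite jacobian_row_mx.
pose D := [set u : 'rV[R]_(l + _) | Lambda (lsubmx u) /\ @Omega R J k (rsubmx u)].
have Ocl := @closed_Omega R J k.
have Dcl : closed D.
  apply: (@closedI _ (lsubmx @^-1` Lambda) (rsubmx @^-1` (@Omega R J k))).
    apply: preimage_closed => // u _; apply: differentiable_continuous.
    exact: differentiable_lsubmx.
  apply: preimage_closed => // u _; apply: differentiable_continuous.
  exact: differentiable_rsubmx.
have DPE z : D (P z) <-> feasible Lambda F G H z.
  rewrite /D /P /= row_mxKl row_mxKr OE /feasible /=.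
  by split=> [[? []]|[]].
have FE : feasible Lambda F G H = [set z | D (P z)].
  by apply/seteqP; split=> z /DPE.
(* Tangents and directional normals of [D] have components in the cones of its factors; this
   inclusion alone lets (B) imply the directional condition for [P] and [D]. *)
have split_normal w v : dir_normal_cone D (P zs) (w *m 'J P zs) v ->
    dir_normal_cone Lambda (F zs) (w *m 'J F zs) (lsubmx v) /\
    dir_normal_cone (@Omega R J k) (GH' zs) (row_mx (w *m 'J G zs) (w *m 'J H zs)) (rsubmx v).
  by rewrite JP !mul_mx_row -{1}[v]hsubmxK; exact: dir_normal_row_mx.
have split_tangent w : tangent_cone D (P zs) (w *m 'J P zs) ->
    tangent_cone Lambda (F zs) (w *m 'J F zs) /\
    tangent_cone (@Omega R J k) (GH' zs) (row_mx (w *m 'J G zs) (w *m 'J H zs)).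
  by rewrite JP !mul_mx_row; exact: tangent_row_mx.
have [||kappa kappa0 hk] := @directional_error_bound R n _ D P zs Dcl CP.1 (CP.2 zs).
- exact/DPE.
- move=> w w0 /split_tangent[TL TO] v eqv /split_normal[NL NO].
  have vE : v = row_mx (lsubmx v) (row_mx (lsubmx (rsubmx v)) (rsubmx (rsubmx v))).
    by rewrite !hsubmxK.
  move: eqv; rewrite JP {1}vE !tr_row_mx !mul_row_col addrA => eqv.
  rewrite -[rsubmx v]hsubmxK in NO.
  by have [v1 v2 v3] := cB w w0 TL TO _ _ _ eqv NL NO; rewrite vE v1 v2 v3 !row_mx0.
(* The same [kappa] serves: the distance to [D] is at most the distance to [Lambda] plus that to
   [Omega], and the latter is at most the sum over the blocks. *)
exists kappa => //; apply: filterS hk => z; rewrite -FE => /le_trans; apply.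
rewrite ler_pM2l//.
apply: le_trans (edistance_row_mx _ _ Lcl Ocl _ _) _.
- by exists (F zs).
- by exists (GH' zs).
by rewrite lerD2l; exact: edistance_Omega.
Qed.
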